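(* Let $n\ge1$, $q\in(0,n/2)$, $\gamma\in[0,n)$, and let $p$ satisfy $$1<p<p_{\mathrm{crit}}(n,q,\gamma):=1+\frac{2+\gamma}{n-q}.$$ Let $(u_0,u_1)\in\mathcal{Y}^q(\mathbb{R}^n)\times\mathcal{Y}^q(\mathbb{R}^n)$ be such that, for some constant $c>0$, $$u_0(x)+u_1(x)\ \ge\ c\,\langle x\rangle^{-n+q}\qquad\text{for } x\in\mathbb{R}^n,$$ where $\langle x\rangle=(1+|x|^2)^{1/2}$. Let $\varepsilon>0$. Then there is no global (in time) weak solution to the Cauchy problem $$\begin{cases}u_{tt}-\Delta u+u_t=\mathcal{I}_\gamma(|u|^p), & x\in\mathbb{R}^n,\ t>0,\\ u(0,x)=\varepsilon u_0(x),\quad u_t(0,x)=\varepsilon u_1(x), & x\in\mathbb{R}^n.\end{cases}$$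
   Context: Riesz potential: for $0<\gamma<n$, $\mathcal{I}_\gamma f(x)=C_{n,\gamma}\int_{\mathbb{R}^n}|x-y|^{-(n-\gamma)}f(y)\,dy$ with $C_{n,\gamma}=\Gamma(\frac{n-\gamma}{2})/(2^\gamma\pi^{n/2}\Gamma(\frac\gamma2))$, taken in the space variable; $\mathcal{I}_0$ is the identity. Pseudo-measure space: $\mathcal{Y}^q(\mathbb{R}^n)$ is the set of tempered distributions $f$ with $\widehat f\in L^1_{\mathrm{loc}}(\mathbb{R}^n)$ and $\|f\|_{\mathcal{Y}^q}:=\sup_{\xi\in\mathbb{R}^n}|\xi|^q|\widehat f(\xi)|<\infty$. The data $u_0,u_1$ are understood to be (locally integrable) functions, so that the pointwise lower bound makes sense. Weak solution: for $T\in(0,\infty]$, $u\in\mathcal{C}([0,T),L^2(\mathbb{R}^n))$ is a weak solution on $[0,T)$ if for all $\chi\in\mathcal{C}_0^\infty([0,T))$ and $\phi\in\mathcal{C}_0^\infty(\mathbb{R}^n)$ $$\int_0^T\!\!\int_{\mathbb{R}^n}\mathcal{I}_\gamma(|u|^p)(t,x)\,\phi(x)\chi(t)\,dx\,dt=\int_0^T\!\!\int_{\mathbb{R}^n}(\partial_t^2-\Delta+\partial_t)u(t,x)\,\phi(x)\chi(t)\,dx\,dt,$$ where the right-hand side is understood after integrating by parts and using the initial conditions, i.e. $$\int_0^T\!\!\int\mathcal{I}_\gamma(|u|^p)\phi\chi\,dx\,dt+\varepsilon\chi(0)\int(u_0+u_1)\phi\,dx-\varepsilon\chi'(0)\int u_0\phi\,dx=\int_0^T\!\!\int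 u\,\big(\phi\chi''-\phi\chi'-\chi\Delta\phi\big)\,dx\,dt$$ (it is part of the definition that the integrals are well defined and finite). It is local in time if $T<\infty$ and global in time if $T=\infty$. Here $\mathcal{C}_0^\infty([0,T))$ denotes smooth functions on $[0,T)$ with compact support in $[0,T)$ (not necessarily vanishing at $0$). *)

(* Defs.v *)
From HB Require Import structures.
From mathcomp Require Import all_boot all_order all_algebra.
From mathcomp Require Import all_classical all_reals all_analysis.
From mathcomp Require Import complex.

Set Implicit Arguments.
Unset Strict Implicit.
Unset Printing Implicit Defensive.

Import Order.TTheory GRing.Theory Num.Theory.
Import numFieldNormedType.Exports.

Local Open Scope classical_set_scope.
Local Open Scope ring_scope.

(* R^n is 'rV[R]_n. The library norm `|x| on row vectors is the sup norm; it
   only provides the topology. The Euclidean norm is [enorm]. *)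

Definition measure_rV_display : measure_display.
Proof. exact: default_measure_display. Qed.

Section measurable_rV.
Context {R : realType} {n : nat}.

Let coords : 'I_n -> 'rV[R]_n -> measurableTypeR R := fun i x => x ord0 i.

Let rV_set0 : g_sigma_preimage coords set0.
Proof. exact: sigma_algebra0. Qed.

Let rV_setC A : g_sigma_preimage coords A -> g_sigma_preimage coords (~` A).
Proof. exact: sigma_algebraC. Qed.

Let rV_bigcup (F : (set 'rV[R]_n)^nat) :
  (forall i, g_sigma_preimage coords (F i)) ->
  g_sigma_preimage coords (\bigcup_i (F i)).
Proof. exact: sigma_algebra_bigcup. Qed.

(* the sigma-algebra generated by the coordinates, i.e. the Borel one *)
HB.instance Definition _ := @isMeasurable.Build measure_rV_display
  'rV[R]_n (g_sigma_preimage coords) rV_set0 rV_setC rV_bigcup.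

Lemma measurable_rV_coord (i : 'I_n) :
  measurable_fun [set: 'rV[R]_n] (fun x => x ord0 i : measurableTypeR R).
Proof.
move=> _ Y mY; rewrite setTI; apply: sub_sigma_algebra => /=.
rewrite -bigcup_seq/=; exists i => /=; first by rewrite mem_index_enum.
by exists Y => //; rewrite setTI.
Qed.

Lemma measurable_fun_rVP d (T : measurableType d) (f : T -> 'rV[R]_n) :
  measurable_fun [set: T] f <->
  forall i, measurable_fun [set: T] (fun x => f x ord0 i : measurableTypeR R).
Proof.
split=> [mf i|mf].
  exact: (measurableT_comp (measurable_rV_coord i) mf).
have : g_sigma_preimage (fun i => coords i \o f) `<=` measurable.
  apply: smallest_sub; first exact: sigma_algebra_measurable.
  rewrite -bigcup_seq => B [i _] [A mA <-].
  exact: mf.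
rewrite g_sigma_preimage_comp => prefS _ A mA; apply: prefS.
by exists A.
Qed.

End measurable_rV.

Section lebesgue_rV.
Context {R : realType}.
Local Open Scope ereal_scope.

Definition rV_cons n (z : measurableTypeR R * 'rV[R]_n) : 'rV[R]_n.+1 :=
  row_mx (const_mx z.1 : 'rV[R]_1) z.2.

Definition rV_uncons n (x : 'rV[R]_n.+1) : measurableTypeR R * 'rV[R]_n :=
  (x ord0 ord0, rsubmx (x : 'rV[R]_(1 + n))).

Lemma rV_unconsK n : cancel (@rV_uncons n) (@rV_cons n).
Proof.
move=> x; rewrite /rV_cons /rV_uncons /=; apply/rowP => i.
rewrite mxE; case: splitP => j ij; rewrite !mxE; congr (x _ _).
  by apply/val_inj; rewrite /= ij ord1.
exact/val_inj.
Qed.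

Lemma rV_consK n : cancel (@rV_cons n) (@rV_uncons n).
Proof.
move=> [t x]; rewrite /rV_cons /rV_uncons /= row_mxKr; congr pair.
have -> : (ord0 : 'I_n.+1) = lshift n (ord0 : 'I_1) by exact/val_inj.
by apply: etrans (row_mxEl _ _ _ _) _; rewrite mxE.
Qed.

Lemma measurable_rV_cons n : measurable_fun setT (@rV_cons n).
Proof.
apply/measurable_fun_rVP => i; case: (split_ordP (i : 'I_(1 + n))) => j ->.
  apply: (eq_measurable_fun fst) => [z _|]; last exact: measurable_fst.
  by apply/esym/(etrans (row_mxEl _ _ _ _)); rewrite mxE.
apply: (eq_measurable_fun (fun z : _ * 'rV[R]_n => z.2 ord0 j)) => [z _|].
  exact/esym/row_mxEr.
exact: (measurableT_comp (measurable_rV_coord j) measurable_snd).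
Qed.

Lemma measurable_rV_uncons n : measurable_fun setT (@rV_uncons n).
Proof.
apply/measurable_fun_pairP; split; first exact: measurable_rV_coord.
apply/measurable_fun_rVP => i /=.
under eq_fun do rewrite mxE.
exact: measurable_rV_coord.
Qed.

Section step.
Variables (n : nat) (mu : {sigma_finite_measure set 'rV[R]_n -> \bar R}).

Definition rV_step : set 'rV[R]_n.+1 -> \bar R :=
  pushforward (@lebesgue_measure R \x mu) (@rV_cons n).

Let mcons := @measurable_rV_cons n.

Let rV_step0 : rV_step set0 = 0.
Proof. by rewrite /rV_step /pushforward preimage_set0 measure0. Qed.

Let rV_step_ge0 A : 0 <= rV_step A.
Proof. exact: measure_ge0. Qed.

Let rV_step_sigma_additive : semi_sigma_additive rV_step.
Proof. exact: (@measure_semi_sigma_additive _ _ _ (pushforward _ _)). Qed.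

HB.instance Definition _ := isMeasure.Build _ _ _ rV_step
  rV_step0 rV_step_ge0 rV_step_sigma_additive.

Let sigma_finite_rV_step : sigma_finite setT rV_step.
Proof.
have /sigma_finiteP[F [FT ndF Foo]] := sigma_finiteT (@lebesgue_measure R).
have /sigma_finiteP[G [GT ndG Goo]] := sigma_finiteT mu.
exists (fun k => @rV_uncons n @^-1` (F k `*` G k)).
  rewrite -preimage_bigcup -[LHS](@preimage_setT _ _ (@rV_uncons n)).
  congr preimage; apply/esym; rewrite -subTset => -[t x] _.
  have [k _ Ft] : (\bigcup_k F k) t by rewrite -FT.
  have [l _ Gx] : (\bigcup_l G l) x by rewrite -GT.
  exists (maxn k l) => //; split => /=.
    by move: t Ft; exact/subsetPset/ndF/leq_maxl.
  by move: x Gx; exact/subsetPset/ndG/leq_maxr.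
move=> k; have [mF Fk] := Foo k; have [mG Gk] := Goo k; split.
  rewrite -[X in measurable X]setTI.
  by apply: measurable_rV_uncons => //; exact: measurableX.
rewrite /rV_step /pushforward -comp_preimage.
rewrite (_ : @rV_uncons n \o @rV_cons n = id); last first.
  by apply/funext => z; exact: rV_consK.
by rewrite preimage_id product_measure1E// lte_mul_pinfty// ge0_fin_numE.
Qed.

HB.instance Definition _ :=
  Measure_isSigmaFinite.Build _ _ _ rV_step sigma_finite_rV_step.
End step.

(* n-dimensional Lebesgue measure on Borel sets: n-fold product of the
   one-dimensional one *)
Fixpoint lebesgue_rV (n : nat) :
    {sigma_finite_measure set 'rV[R]_n -> \bar R} :=
  if n is m.+1 return {sigma_finite_measure set 'rV[R]_n -> \bar R}
  then rV_step (lebesgue_rV m)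
  else \d_(0%R : 'rV[R]_0).

End lebesgue_rV.

Lemma lebesgue_rV_box (R : realType) n (A : 'I_n -> set (measurableTypeR R)) :
  (forall i, measurable (A i)) ->
  (lebesgue_rV n [set x : 'rV[R]_n | forall i, A i (x ord0 i)] =
   \prod_(i < n) lebesgue_measure (A i))%E.
Proof.
elim: n A => [|n IH] A mA.
  by rewrite big_ord0 /= diracE mem_set //= => -[].
rewrite big_ord_recl -(IH (fun i => A (lift ord0 i))) //.
rewrite -product_measure1E //=; last first.
  rewrite (_ : [set _ | _] = \bigcap_(i in [set: 'I_n])
     ((fun x : 'rV[R]_n => x ord0 i : measurableTypeR R) @^-1` A (lift ord0 i))); last first.
    by apply/seteqP; split=> x /= h i; [move=> _|]; exact: h.
  apply: fin_bigcap_measurable => // i _.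
  by rewrite -[X in measurable X]setTI; exact: measurable_rV_coord.
rewrite /= /rV_step /pushforward; congr (_ \x _)%E.
apply/seteqP; split=> -[t x] /=.
  move=> h; split.
    have := h ord0; have := rV_consK (t, x); rewrite /rV_uncons => /(congr1 fst) /= E.
    by rewrite E.
  move=> i; have := h (lift ord0 i).
  rewrite (_ : rV_cons (t, x) ord0 (lift ord0 i) = x ord0 i) //.
  rewrite (_ : lift ord0 i = rshift 1 i); last exact/val_inj.
  exact: row_mxEr.
move=> [At Ax] i; case: (split_ordP (i : 'I_(1 + n))) => j ->.
  rewrite (_ : rV_cons (t, x) ord0 (lshift n j) = t); last first.
    by apply: etrans (row_mxEl _ _ _ _) _; rewrite mxE.
  by rewrite (_ : lshift n j = ord0) //; apply/val_inj; rewrite /= ord1.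
rewrite (_ : rV_cons (t, x) ord0 (rshift 1 j) = x ord0 j); last exact: row_mxEr.
by rewrite (_ : rshift 1 j = lift ord0 j) //; exact/val_inj.
Qed.

Section calculus.
Context {R : realType} {n : nat}.
Implicit Types (x y xi : 'rV[R]_n) (f : 'rV[R]_n -> R) (phi : 'rV[R]_n -> R[i]).

Definition dotprod x y : R := \sum_(i < n) x ord0 i * y ord0 i.

Definition enorm x : R := Num.sqrt (dotprod x x).

Definition japanese_bracket x : R := Num.sqrt (1 + enorm x ^+ 2).

Definition partial (i : 'I_n) f : 'rV[R]_n -> R := 'D_(delta_mx ord0 i) f.

(* iterated partial derivative along a list of coordinate directions *)
Definition partials (s : seq 'I_n) f : 'rV[R]_n -> R := foldr partial f s.

Definition laplacian f x : R := \sum_(i < n) partial i (partial i f) x.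

Definition smooth f : Prop := forall s : seq 'I_n,
  continuous (partials s f) /\
  forall i x, derivable (partials s f) x (delta_mx ord0 i).

Definition test_function f : Prop :=
  smooth f /\ compact (closure [set x | f x != 0]).

Definition locally_integrable_rV f : Prop :=
  measurable_fun setT f /\
  forall K : set 'rV[R]_n, compact K ->
    (\int[lebesgue_rV n]_(x in K) `|f x|%:E < +oo)%E.

Definition re_part phi : 'rV[R]_n -> R := fun x => complex.Re (phi x).
Definition im_part phi : 'rV[R]_n -> R := fun x => complex.Im (phi x).

Definition cmod (z : R[i]) : R := ComplexField.Normc.normc z.

Definition cpartials (s : seq 'I_n) phi : 'rV[R]_n -> R[i] :=
  fun x => Complex (partials s (re_part phi) x) (partials s (im_part phi) x).

Definition cintegral phi : R[i] :=
  Complex (\int[lebesgue_rV n]_x re_part phi x)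
          (\int[lebesgue_rV n]_x im_part phi x).

Definition ctest_function phi : Prop :=
  test_function (re_part phi) /\ test_function (im_part phi).

Definition schwartz_norm (N : nat) phi : \bar R :=
  ereal_sup [set r | exists (s : seq 'I_n) x, (size s <= N)%N /\
    r = ((1 + enorm x) ^+ N * cmod (cpartials s phi x))%:E].

Definition schwartz phi : Prop :=
  [/\ smooth (re_part phi), smooth (im_part phi) &
      forall N, (schwartz_norm N phi < +oo)%E].

(* A distribution is a functional on all functions R^n -> C of which only the
   values on the Schwartz class matter. *)
Definition distribution_rV := ('rV[R]_n -> R[i]) -> R[i].

Definition tempered (S : distribution_rV) : Prop :=
  (forall (a : R[i]) phi psi, schwartz phi -> schwartz psi ->
     S (fun x => a * phi x + psi x) = a * S phi + S psi) /\
  (exists (C : R) (N : nat), forall phi, schwartz phi ->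
     ((cmod (S phi))%:E <= C%:E * schwartz_norm N phi)%E).

(* S is the distribution defined by the locally integrable function g; the
   integral of g * phi is only required to compute S for phi in C_0^oo, since
   it need not converge for every Schwartz function phi. *)
Definition represents (S : distribution_rV) (g : 'rV[R]_n -> R[i]) : Prop :=
  [/\ locally_integrable_rV (re_part g), locally_integrable_rV (im_part g) &
      forall phi, ctest_function phi ->
        S phi = cintegral (fun x => g x * phi x)].

(* the constant in front of the integral and the factor in the exponent do not
   affect the spaces Y^q *)
Definition fourier phi xi : R[i] :=
  cintegral (fun x =>
    Complex (cos (dotprod x xi)) (- sin (dotprod x xi)) * phi x).

Definition fourier_distribution (S : distribution_rV) : distribution_rV :=
  fun phi => S (fourier phi).

Definition pseudo_measure (q : R) (S : distribution_rV) : Prop :=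
  tempered S /\
  exists g, represents (fourier_distribution S) g /\
    (ereal_sup (range (fun xi => (enorm xi `^ q * cmod (g xi))%:E)) < +oo)%E.

(* the real function f is locally integrable and belongs to Y^q *)
Definition pseudo_measure_fun (q : R) f : Prop :=
  exists S, pseudo_measure q S /\ represents S (fun x => Complex (f x) 0).

End calculus.

Definition Gamma_fun {R : realType} (s : R) : R :=
  \int[lebesgue_measure]_(t in `]0, +oo[) (t `^ (s - 1) * expR (- t)).

Definition riesz_const {R : realType} (n : nat) (gamma : R) : R :=
  Gamma_fun ((n%:R - gamma) / 2) /
  (2 `^ gamma * pi `^ (n%:R / 2) * Gamma_fun (gamma / 2)).

(* for f >= 0; the value may be +oo *)
Definition riesz {R : realType} {n : nat} (gamma : R) (f : 'rV[R]_n -> R)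
    (x : 'rV[R]_n) : \bar R :=
  if gamma == 0 then (f x)%:E else
  ((riesz_const n gamma)%:E *
    \int[lebesgue_rV n]_y (enorm (x - y) `^ (- (n%:R - gamma)) * f y)%:E)%E.

Section weak_solution.
Context {R : realType} {n : nat}.

Definition time_itv (T : \bar R) : set R := [set t | 0 <= t /\ (t%:E < T)%E].

Definition space_time (T : \bar R) : set (measurableTypeR R * 'rV[R]_n) :=
  time_itv T `*` setT.

Definition space_time_measure :
    {measure set (measurableTypeR R * 'rV[R]_n) -> \bar R} :=
  (@lebesgue_measure R \x lebesgue_rV n)%E.

(* C([0,T), L^2(R^n)): every such curve of classes has a jointly Borel
   representative, unique for each t up to a null set *)
Definition continuous_L2 (T : \bar R) (u : R -> 'rV[R]_n -> R) : Prop :=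
  [/\ measurable_fun (space_time T) (fun z => u z.1 z.2),
      forall t, time_itv T t -> u t \in Lfun (lebesgue_rV n) 2%:E &
      forall t, time_itv T t ->
        Lnorm (lebesgue_rV n) 2%:E (EFin \o (u s \- u t))
          @[s --> within (time_itv T) (nbhs t)] --> (0 : \bar R)].

(* C_0^oo([0,T)), as restrictions to [0,T) of smooth functions on R; functions
   smooth up to 0 extend smoothly to the left of 0 *)
Definition time_test_function (T : \bar R) (chi : R -> R) : Prop :=
  (forall k t, derivable (derive1n k chi) t 1) /\
  exists b, time_itv T b /\ forall t, b < t -> chi t = 0.

Definition weak_solution (gamma p eps : R) (u0 u1 : 'rV[R]_n -> R)
    (T : \bar R) (u : R -> 'rV[R]_n -> R) : Prop :=
  continuous_L2 T u /\
  forall (chi : R -> R) (phi : 'rV[R]_n -> R),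
    time_test_function T chi -> test_function phi ->
    let source (z : measurableTypeR R * 'rV[R]_n) : \bar R :=
      (riesz gamma (fun y => `|u z.1 y| `^ p)%R z.2 *
       (phi z.2 * chi z.1)%:E)%E in
    let linear_part (z : measurableTypeR R * 'rV[R]_n) : \bar R :=
      (u z.1 z.2 *
       (phi z.2 * derive1n 2 chi z.1 - phi z.2 * derive1 chi z.1
        - chi z.1 * laplacian phi z.2))%:E in
    let data0 (x : 'rV[R]_n) : \bar R := (u0 x * phi x)%:E in
    let data01 (x : 'rV[R]_n) : \bar R := ((u0 x + u1 x) * phi x)%:E in
    [/\ space_time_measure.-integrable (space_time T) source,
        space_time_measure.-integrable (space_time T) linear_part,
        (lebesgue_rV n).-integrable setT data0,
        (lebesgue_rV n).-integrable setT data01 &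
        (\int[space_time_measure]_(z in space_time T) source z
         + (eps * chi 0)%:E * \int[lebesgue_rV n]_x data01 x
         - (eps * derive1 chi 0)%:E * \int[lebesgue_rV n]_x data0 x
         = \int[space_time_measure]_(z in space_time T) linear_part z)%E].

Definition global_weak_solution (gamma p eps : R) (u0 u1 : 'rV[R]_n -> R)
    (u : R -> 'rV[R]_n -> R) : Prop :=
  weak_solution gamma p eps u0 u1 +oo%E u.

End weak_solution.

Definition p_crit {R : realType} (n : nat) (q gamma : R) : R :=
  1 + (2 + gamma) / (n%:R - q).

(* Main.v *)
Require Import Defs.
From mathcomp Require Import all_boot all_order all_algebra.
From mathcomp Require Import all_classical all_reals all_analysis.
From mathcomp Require Import ring lra.

(* Test the weak formulation against phi(x / r) chi(t / r^2) for a large r, where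
   phi and chi are bumps built from exp (-1/s), so that chi'(0) = 0 and
   |h'|, |h''| <= C h^(1/p) for each one-dimensional factor h.  By Young's
   inequality the linear part is at most
     l int |u|^p phi chi + K l^(-1/(p-1)) r^(n - 2/(p-1)) for every l > 0.
   On the support of phi the Riesz kernel is at least (2 n r)^-(n - gamma), hence
   by Tonelli the source is at least k r^gamma int |u|^p phi chi.  Taking
   l = k r^gamma cancels the unknown u, and the data, which are at least of order
   r^q, are bounded by a multiple of r^(n - (2 + gamma)/(p-1)).  For p < p_crit
   the last exponent is smaller than q, a contradiction as r tends to infinity. *)

Set Implicit Arguments.
Unset Strict Implicit.
Unset Printing Implicit Defensive.

Import Order.TTheory GRing.Theory Num.Theory.
Import numFieldNormedType.Exports.
(* The imports above hide the measurable structure of the extended reals. *)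
From mathcomp Require Import measurable_realfun.

Local Open Scope classical_set_scope.
Local Open Scope ring_scope.

(** * Positivity of the Gamma function *)

Section gamma.
Context {R : realType}.
Notation mu := (@lebesgue_measure R).

(** A single term of the exponential series is at most its sum. This controls both the tail of the
    Gamma integral and the powers of 1/r in the bump. *)
Lemma pow_expR_le (k : nat) (x : R) : 0 <= x -> x ^+ k <= k`!%:R * expR x.
Proof.
move=> x0; case: k => [|k].
  by rewrite expr0 fact0 mul1r -expR0 ler_expR.
have fk : (0 : R) < k.+1`!%:R by rewrite ltr0n fact_gt0.
rewrite mulrC -ler_pdivrMr//.
by apply: le_trans (expR_ge1Dxn k x0); rewrite lerDr.
Qed.

(** For s < 1 the integrand is unbounded at 0, so the integral is taken as a monotone limit over
    segments away from 0, where t^s / s is an antiderivative. *)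
Lemma integral_powR_01 (s : R) : 0 < s ->
  (\int[mu]_(t in `]0%R, 1%R]) (t `^ (s - 1))%:E <= (s^-1)%:E)%E.
Proof.
move=> s0.
(* Starting at 1/2 rather than at 1 keeps every segment nondegenerate, as the fundamental theorem of
   calculus needs. *)
pose F (i : nat) : set R := `[i.+2%:R^-1, 1]%classic.
have e : `]0%R, 1%R]%classic = \bigcup_i F i.
  apply/seteqP; split=> t; rewrite /= in_itv/=.
    move=> /andP[t0 t1]; exists (Num.truncn t^-1) => //; rewrite /F /= in_itv/= t1 andbT.
    rewrite -[leRHS]invrK lef_pV2 ?posrE ?invr_gt0 ?ltr0n//.
    have /truncn_itv/andP[_ /ltW h] : 0 <= t^-1 by rewrite invr_ge0 ltW.
    by apply: le_trans h _; rewrite ler_nat.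
  move=> [i _]; rewrite /F/= in_itv/= => /andP[h ->]; rewrite andbT.
  by apply: lt_le_trans h; rewrite invr_gt0.
have mf (A : set R) : measurable_fun A (EFin \o (fun t : R => t `^ (s - 1))).
  by apply/measurable_funTS/measurable_EFinP; exact: measurable_powR.
have := @ge0_nondecreasing_set_cvg_integral _ (measurableTypeR R) R F
  (fun t => (t `^ (s - 1))%:E) mu.
rewrite -e => /(_ _ _ (fun i => mf _) (fun i x _ => _)) H.
have cv : (\int[mu]_(x in F i) (x `^ (s - 1))%:E)%E @[i --> \oo]
    --> (\int[mu]_(x in `]0%R, 1%R]) (x `^ (s - 1))%:E)%E.
  apply: H => //.
  - move=> i j ij; apply/subsetPset => x; rewrite /F/= !in_itv/= => /andP[h ->].
    rewrite andbT; apply: le_trans h.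
    by rewrite lef_pV2 ?posrE ?ltr0n// ler_nat !ltnS.
  - by move=> i; exact: measurable_itv.
  - by move=> i; rewrite lee_fin powR_ge0.
rewrite -(cvg_lim _ cv)//; apply: lime_le; first by apply/cvg_ex; eexists; exact: cv.
near=> i.
have i1 : (i.+2%:R^-1 : R) < 1 by rewrite invf_lt1 ?ltr0n// ltr1n.
have i0 : (0 : R) < i.+2%:R^-1 by rewrite invr_gt0 ltr0n.
have dF (x : R) : 0 < x -> is_derive x 1 (fun t : R => s^-1 * t `^ s) (x `^ (s - 1)).
  move=> x0; apply: (is_derive_eq (is_deriveZ s^-1 (is_derive1_powR s x0))).
  by rewrite /GRing.scale/= mulrA mulVf ?gt_eqF// mul1r.
have cP (r x : R) : 0 < x -> {for x, continuous (fun t : R => t `^ r)}.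
  move=> x0; apply/differentiable_continuous/derivable1_diffP.
  by apply: derivable_powR; rewrite in_itv/= x0.
have cF (x : R) : 0 < x -> {for x, continuous (fun t : R => s^-1 * t `^ s)}.
  move=> x0; apply/differentiable_continuous/derivable1_diffP.
  exact: (@ex_derive _ _ _ _ _ _ _ (dF x x0)).
rewrite /F (@continuous_FTC2 _ _ (fun t => s^-1 * t `^ s))//.
- by rewrite powR1 mulr1 -EFinB lee_fin gerBl mulr_ge0// ?powR_ge0// invr_ge0 ltW.
- apply/continuous_in_subspaceT => x; rewrite inE/= in_itv/= => /andP[h _].
  by apply: cP; exact: lt_le_trans h.
- split.
  + move=> x; rewrite in_itv/= => /andP[h _].
    exact: (@ex_derive _ _ _ _ _ _ _ (dF x (lt_trans i0 h))).
  + by apply/cvg_at_right_filter; apply: cF.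
  + by apply/cvg_at_left_filter; apply: cF.
- move=> x; rewrite in_itv/= => /andP[h _].
  by rewrite derive1E (@derive_val _ _ _ _ _ _ _ (dF x (lt_trans i0 h))).
Unshelve. all: by end_near. Qed.

(** Split at 1: below it the exponential is at most 1, above it the integrand is dominated by a
    multiple of the exponential density of rate 1/2. *)
Lemma integral_gamma_lty (s : R) : 0 < s ->
  (\int[mu]_(t in `]0%R, +oo[) (t `^ (s - 1) * expR (- t))%:E < +oo)%E.
Proof.
move=> s0.
have mf (A : set R) :
    measurable_fun A (EFin \o (fun t : R => t `^ (s - 1) * expR (- t))).
  apply/measurable_funTS/measurable_EFinP; apply: measurable_funM.
    exact: measurable_powR.
  exact: (measurableT_comp (@measurable_expR R) (@oppr_measurable R setT)).
have mp (A : set R) : measurable_fun A (EFin \o (fun t : R => t `^ (s - 1))).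
  by apply/measurable_funTS/measurable_EFinP; exact: measurable_powR.
have -> : `]0%R, +oo[%classic = `]0%R, 1%R]%classic `|` `]1%R, +oo[%classic :> set R.
  by rewrite -itv_bndbnd_setU// bnd_simp.
rewrite ge0_integral_setU//=; last 3 first.
- exact: mf.
- by move=> t _; rewrite lee_fin mulr_ge0// ?powR_ge0 ?expR_ge0.
- apply/disj_setPS => t /= []; rewrite !in_itv/= => /andP[_ t1] /andP[].
  by rewrite ltNge t1.
apply: lte_add_pinfty.
  apply: le_lt_trans (ltry s^-1); apply: le_trans (integral_powR_01 s0).
  apply: ge0_le_integral => //.
  - by move=> t _; rewrite lee_fin mulr_ge0// ?powR_ge0 ?expR_ge0.
  - exact: mf.
  - exact: mp.
  - move=> t /=; rewrite in_itv/= => /andP[t0 _].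
    by rewrite lee_fin ler_piMr ?powR_ge0// -expR0 ler_expR oppr_le0 ltW.
(* Since m > s, t^(s-1) <= t^m for t >= 1, and t^m exp (-t/2) <= C follows from [pow_expR_le] at
   t/2. The extra factor 2 below offsets the rate 1/2 in the density. *)
pose m := (Num.truncn s).+1; pose C : R := 2 ^+ m * m`!%:R.
have C0 : 0 <= C by rewrite mulr_ge0// exprn_ge0.
apply: (@le_lt_trans _ _
   (\int[mu]_(t in `]1%R, +oo[) ((C * 2)%:E * (exponential_pdf 2^-1 t)%:E))%E).
  apply: ge0_le_integral => //.
  - by move=> t _; rewrite lee_fin mulr_ge0// ?powR_ge0 ?expR_ge0.
  - exact: mf.
  - apply/measurable_EFinP/measurable_funM => //.
    by apply: measurable_funTS; exact: measurable_exponential_pdf.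
  - move=> t /=; rewrite in_itv/= => /andP[t1 _].
    have t0 : 0 <= t by rewrite (le_trans _ (ltW t1)).
    rewrite -EFinM lee_fin exponential_pdfE//.
    have -> : C * 2 * (2^-1 * expR (- 2^-1 * t)) = C * expR (- 2^-1 * t) by field.
    have -> : - t = t / -2 + t / -2 by field.
    rewrite expRD mulrA (_ : t / -2 = - 2^-1 * t); last by field.
    rewrite ler_wpM2r ?expR_ge0//.
    apply: (@le_trans _ _ (t ^+ m * expR (- 2^-1 * t))).
      rewrite ler_wpM2r ?expR_ge0// -powR_mulrn// ler_powR// ?(ltW t1)//.
      have /truncn_itv/andP[_ /ltW] := ltW s0; rewrite /m; lra.
    have := @pow_expR_le m (2^-1 * t); rewrite exprMn mulNr expRN => /(_ _)/wrap[].
      by rewrite mulr_ge0// invr_ge0.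
    move=> h; rewrite ler_pdivrMr ?expR_gt0// /C -mulrA -ler_pdivrMl ?exprn_gt0//.
    by rewrite -exprVn.
rewrite ge0_integralZl//; last 3 first.
- by apply/measurable_EFinP/measurable_funTS; exact: measurable_exponential_pdf.
- by move=> t _; rewrite lee_fin exponential_pdf_ge0// invr_ge0.
- by rewrite lee_fin mulr_ge0.
rewrite lte_mul_pinfty ?lee_fin ?mulr_ge0//.
apply: (@le_lt_trans _ _ 1%E); last exact: ltey.
rewrite -(@integral_exponential_pdf R 2^-1) ?invr_gt0//.
apply: ge0_subset_integral => //.
- by apply/measurable_EFinP; exact: measurable_exponential_pdf.
- by move=> t _; rewrite lee_fin exponential_pdf_ge0// invr_ge0.
Qed.

(** The real-valued integral would be 0 if the extended one were +oo, so finiteness is needed as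
    well as a positive lower bound, taken from [1, 2]. *)
Lemma Gamma_fun_gt0 (s : R) : 0 < s -> 0 < Gamma_fun s.
Proof.
move=> s0; rewrite /Gamma_fun /Rintegral fine_gt0// integral_gamma_lty// andbT.
have mf (A : set R) :
    measurable_fun A (EFin \o (fun t : R => t `^ (s - 1) * expR (- t))).
  apply/measurable_funTS/measurable_EFinP; apply: measurable_funM.
    exact: measurable_powR.
  exact: (measurableT_comp (@measurable_expR R) (@oppr_measurable R setT)).
(* The power t^(s-1) is monotone, in a direction that depends on the sign of s - 1, so its minimum
   on [1, 2] is at an endpoint. *)
pose c : R := Num.min 1 (2 `^ (s - 1)) * expR (- 2).
have c0 : 0 < c by rewrite mulr_gt0 ?expR_gt0// lt_min ltr01 powR_gt0.
apply: (@lt_le_trans _ _ (\int[mu]_(t in `[1%R, 2%R]) c%:E)%E).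
  rewrite integral_cst//= lebesgue_measure_itv/= lte_fin ltr1n/= -EFinD -EFinM lte_fin.
  by rewrite mulr_gt0//; lra.
apply: (@le_trans _ _
   (\int[mu]_(t in `[1%R, 2%R]) (t `^ (s - 1) * expR (- t))%:E)%E).
  apply: ge0_le_integral => //.
  - by move=> t _; rewrite lee_fin ltW.
  - exact: mf.
  - move=> t /=; rewrite in_itv/= => /andP[t1 t2]; rewrite lee_fin; apply: ler_pM.
    + by rewrite le_min ler01 powR_ge0.
    + exact: expR_ge0.
    + rewrite ge_min; have [s1|s1] := leP 0 (s - 1).
        by rewrite -[X in X <= _](powRr0 t) ler_powR.
      have t0 : 0 < t by lra.
      rewrite -[s - 1]opprK (powRN 2) (powRN t) lef_pV2 ?posrE ?powR_gt0//.
      by apply/orP; right; apply: ge0_ler_powR; rewrite ?nnegrE; lra.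
    + by rewrite ler_expR lerN2.
apply: ge0_subset_integral => //.
- exact: mf.
- by move=> t _; rewrite lee_fin mulr_ge0// ?powR_ge0 ?expR_ge0.
- by move=> t /=; rewrite !in_itv/= andbT => /andP[t1 _]; lra.
Qed.

End gamma.

(** * Bump functions *)

Section bump.
Context {R : realType}.

Lemma powexp_decay (k : nat) (th : R) : 0 < th ->
  exists2 C : R, 0 < C & forall r : R, 0 < r -> r ^- k * expR (- th / r) <= C.
Proof.
move=> th0; exists (k`!%:R / th ^+ k).
  by rewrite divr_gt0 ?exprn_gt0// ltr0n fact_gt0.
move=> r r0; have := @pow_expR_le R k (th / r) (divr_ge0 (ltW th0) (ltW r0)).
rewrite mulNr expRN exprMn exprVn => h.
rewrite ler_pdivrMr ?expR_gt0// mulrAC ler_pdivlMr ?exprn_gt0//.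
by rewrite mulrC.
Qed.

(** The difference quotient at 0 is at most C |h|. This is for the point where [flat] is glued to
    0. *)
Lemma is_derive_quad (f : R -> R) (C : R) : f 0 = 0 ->
  (forall s, `|f s| <= C * s ^+ 2) -> is_derive (0 : R) (1 : R) f 0.
Proof.
move=> f0 fC.
have H : (fun h : R => h^-1 *: (f (h *: 1 + 0) - f 0)) @ 0^' --> (0 : R).
  apply/cvgr0Pnorm_le => e e0.
  have C1 : 0 < `|C| + 1 by rewrite ltr_wpDl.
  near=> h.
  have h0 : h != 0 by near: h; exact: nbhs_dnbhs_neq.
  rewrite f0 subr0 addr0 /GRing.scale/= mulr1 normrM normfV.
  rewrite ler_pdivrMl ?normr_gt0//.
  apply: (le_trans (fC h)); rewrite -(real_normK (num_real h)) expr2 mulrCA ler_wpM2l//.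
  apply: (@le_trans _ _ ((`|C| + 1) * `|h|)).
    by rewrite ler_wpM2r//; have := ler_norm C; lra.
  rewrite -ler_pdivlMl//; near: h; apply: dnbhs0_le.
  by rewrite mulr_gt0 ?invr_gt0.
by apply: DeriveDef; [apply/cvg_ex; exists 0|exact: cvg_lim H].
Unshelve. all: by end_near. Qed.

(** The index k makes the family closed under differentiation up to linear combinations, since each
    derivative only raises the power of 1/r. *)
Definition flat (k : nat) (r : R) : R :=
  if 0 < r then r ^- k * expR (- r^-1) else 0.

Lemma flat_ge0 k r : 0 <= flat k r.
Proof.
rewrite /flat; case: ifPn => // r0.
by rewrite mulr_ge0 ?expR_ge0// invr_ge0 exprn_ge0// ltW.
Qed.

Lemma flat_le0 k r : r <= 0 -> flat k r = 0.
Proof. by move=> r0; rewrite /flat ltNge r0. Qed.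

Lemma flat_gt0 k r : 0 < r -> 0 < flat k r.
Proof.
by move=> r0; rewrite /flat r0 mulr_gt0 ?expR_gt0// invr_gt0 exprn_gt0.
Qed.

Lemma flat0_le1 r : flat 0 r <= 1.
Proof.
rewrite /flat; case: ifPn => // r0; rewrite expr0 invr1 mul1r -expR0 ler_expR.
by rewrite oppr_le0 invr_ge0 ltW.
Qed.

Lemma flatSE k r : r * flat k.+1 r = flat k r.
Proof.
rewrite /flat; case: ifPn => [r0|]; last by rewrite mulr0.
by rewrite exprS invfM !mulrA divff ?mul1r// gt_eqF.
Qed.

Lemma ler_flat r s : r <= s -> flat 0 r <= flat 0 s.
Proof.
move=> rs; have [r0|r0] := ltP 0 r; last by rewrite (flat_le0 _ r0) flat_ge0.
have s0 := lt_le_trans r0 rs.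
by rewrite /flat r0 s0 !expr0 !invr1 !mul1r ler_expR lerN2 lef_pV2.
Qed.

(** Split exp (-1/r) into its power th and exp (-(1 - th)/r); the second factor absorbs r^-k. This
    is the source of the bounds of derivatives of a cutoff by a power of the cutoff itself. *)
Lemma flat_powR k (th : R) : 0 < th < 1 -> exists2 C : R, 0 < C &
  forall r, flat k r <= C * flat 0 r `^ th.
Proof.
move=> /andP[th0 th1]; have th10 : 0 < 1 - th by rewrite subr_gt0.
have [C C0 HC] := powexp_decay k th10; exists C => // r.
rewrite /flat; case: ifPn => r0; last by rewrite mulr_ge0 ?powR_ge0// ltW.
rewrite expr0 invr1 mul1r -expRM.
rewrite {1}(_ : - r^-1 = - (1 - th) / r + - r^-1 * th); last first.
  by field; rewrite gt_eqF.
by rewrite expRD mulrA ler_wpM2r ?expR_ge0// HC.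
Qed.

(** Away from 0 this is the product rule or a locally zero function. At 0, [flat k s] is s^2 times
    the bounded [flat k.+2 s], so the derivative is 0. *)
Lemma is_derive_flat k (r : R) :
  is_derive r 1 (flat k) (flat k.+2 r - k%:R * flat k.+1 r).
Proof.
have [r0|r0|->] := ltgtP r 0.
- rewrite !flat_le0 ?(ltW r0)// mulr0 subr0.
  apply: (@near_eq_is_derive _ R R (cst 0)).
  by near=> s; rewrite flat_le0//; near: s; exact: lt_le_nbhsl.
- apply: (@near_eq_is_derive _ _ _ (fun s : R => (s ^+ k)^-1 * expR (- s^-1))).
    near=> s; rewrite /flat ifT//; near: s; exact: lt_nbhsr.
  have rn0 : r != 0 by rewrite gt_eqF.
  have rk0 : r ^+ k != 0 by rewrite expf_neq0.
  have d1 : is_derive r 1 (fun s : R => (s ^+ k)^-1)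
      (- (r ^+ k) ^- 2 *: (k%:R *: r ^+ k.-1 *: 1)).
    apply: (@is_deriveV _ (fun s : R => s ^+ k)) => //.
    by apply: DeriveDef; [exact: exprn_derivable|exact: exp_derive].
  have d2 : is_derive r 1 (fun s : R => expR (- s^-1))
      (expR (- r^-1) * - (- r ^- 2 *: 1)).
    apply: (@is_derive1_comp R expR (fun s : R => - s^-1)).
    apply: is_deriveN.
    exact: (@is_deriveV _ id _ _ _ rn0 (is_derive_id r 1)).
  apply: (is_derive_eq (is_deriveM d1 d2)).
  rewrite /flat r0 /GRing.scale/=.
  case: k rk0 {d1 d2} => [|k] rk0; first by rewrite !expr0 mul0r; field.
  by rewrite !exprS/=; field; rewrite rn0 expf_neq0.
rewrite !flat_le0// mulr0 subr0.
have [C C0 HC] := powexp_decay k.+2 (@ltr01 R).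
apply: (@is_derive_quad _ C); first by rewrite flat_le0.
move=> s; rewrite ger0_norm ?flat_ge0//; have [s0|s0] := ltP 0 s; last first.
  by rewrite (flat_le0 _ s0) mulr_ge0 ?sqr_ge0// ltW.
rewrite -flatSE -flatSE mulrA -expr2 mulrC ler_wpM2r ?sqr_ge0//.
by rewrite /flat s0; have := HC _ s0; rewrite mulN1r.
Unshelve. all: by end_near. Qed.

(* The functions P(t) flat k (1 - a t^2) are closed under differentiation, which
   makes the bump below smooth. *)
Lemma poly_flat_derivable (a : R) (k : nat) (P : {poly R}) (t : R) :
  let Q := 1 - a%:P * 'X^2 in
  is_derive t 1 (fun t => P.[t] * flat k (1 - a * t ^+ 2))
   ((P^`() * Q ^+ 2 - k%:R *: (P * Q^`() * Q) + P * Q^`()).[t]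
     * flat k.+2 (1 - a * t ^+ 2)).
Proof.
move=> Q.
have eQ s : Q.[s] = 1 - a * s ^+ 2 by rewrite !hornerE.
under eq_fun do rewrite -eQ; rewrite -eQ.
have dF : is_derive t 1 (flat k \o horner Q)
    ((flat k.+2 Q.[t] - k%:R * flat k.+1 Q.[t]) * Q^`().[t]).
  exact: is_derive1_comp (is_derive_flat _ _) (is_derive_poly _ _).
apply: (is_derive_eq (is_deriveM (is_derive_poly P t) dF)).
(* Every level is raised to k + 2 at the price of factors Q, which leaves a polynomial identity. *)
move: Q {eQ dF} => Q; rewrite /GRing.scale/= -(flatSE k) -(flatSE k.+1) expr2.
rewrite !(hornerD, hornerN, hornerZ, hornerM).
ring.
Qed.

(** The standard mollifier profile exp (-1 / (1 - a t^2)), extended by 0. *)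
Definition bump (a : R) (t : R) : R := flat 0 (1 - a * t ^+ 2).

Lemma derive1n_bump_poly (a : R) (m : nat) : exists P : {poly R}, exists k : nat,
  derive1n m (bump a) = fun t => P.[t] * flat k (1 - a * t ^+ 2).
Proof.
elim: m => [|m [P [k E]]].
  by exists 1, 0; apply/funext => t; rewrite hornerC mul1r.
rewrite derive1nS E; eexists; exists k.+2; apply/funext => t.
rewrite derive1E (@derive_val _ _ _ _ _ _ _ (poly_flat_derivable a k P t)).
reflexivity.
Qed.

Lemma derivable_bump (a : R) (m : nat) (t : R) : derivable (derive1n m (bump a)) t 1.
Proof.
have [P [k ->]] := derive1n_bump_poly a m.
exact: (@ex_derive _ _ _ _ _ _ _ (poly_flat_derivable a k P t)).
Qed.

Lemma derive1_bump (a t : R) :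
  derive1n 1 (bump a) t = - (2 * a * t) * flat 2 (1 - a * t ^+ 2).
Proof.
have -> : bump a = fun t => (1 : {poly R}).[t] * flat 0 (1 - a * t ^+ 2).
  by apply/funext => s; rewrite hornerC mul1r.
rewrite derive1n1 derive1E (@derive_val _ _ _ _ _ _ _ (poly_flat_derivable a 0 1 t)).
by congr (_ * _); rewrite !poly.derivE !(hornerD, hornerN, hornerM, hornerZ,
  hornerMn, hornerXn, hornerX, hornerC)/=; ring.
Qed.

Lemma derive2_bump (a t : R) :
  let r := 1 - a * t ^+ 2 in
  derive1n 2 (bump a) t =
  a * (- (2 * r ^+ 2) - 8 * a * t ^+ 2 * r + 4 * (a * t ^+ 2)) * flat 4 r.
Proof.
move=> r; rewrite derive1nS.
have -> : derive1n 1 (bump a) =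
    fun t => ((- (2 * a)) *: 'X : {poly R}).[t] * flat 2 (1 - a * t ^+ 2).
  by apply/funext => s; rewrite derive1_bump !hornerE; ring.
rewrite derive1E (@derive_val _ _ _ _ _ _ _ (poly_flat_derivable a 2 _ t)).
by congr (_ * _); rewrite /r !poly.derivE !(hornerD, hornerN, hornerM, hornerZ,
  hornerMn, hornerXn, hornerX, hornerC)/=; ring.
Qed.

End bump.

(** * Size of the bump and of its derivatives *)

Section bounds.
Context {R : realType}.

Lemma bump_ge0 (a t : R) : 0 <= bump a t.
Proof. exact: flat_ge0. Qed.

Lemma bump_le1 (a t : R) : bump a t <= 1.
Proof. exact: flat0_le1. Qed.

Lemma bump_eq0 (b t : R) : 0 < b -> b^-1 <= `|t| -> bump (b ^+ 2) t = 0.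
Proof.
move=> b0 bt; rewrite /bump flat_le0// subr_le0 -exprMn -[X in X <= _](expr1n R 2).
rewrite -[leRHS]real_normK ?num_real// ler_sqr ?nnegrE//.
by rewrite normrM (gtr0_norm b0) -ler_pdivrMl// mulr1.
Qed.

(** On half of the support b |t| <= 1/2, and 3/4 is 1 - (1/2)^2. *)
Lemma bump_ge (b t : R) : 0 < b -> `|t| <= (2 * b)^-1 ->
  flat 0 (3 / 4) <= bump (b ^+ 2) t.
Proof.
move=> b0 bt; apply: ler_flat.
have : b * `|t| <= 2^-1.
  by rewrite -ler_pdivlMl// -invfM mulrC.
have : 0 <= b * `|t| by rewrite mulr_ge0// ltW.
rewrite -[t ^+ 2]real_normK ?num_real// -exprMn; nra.
Qed.

(** Each derivative yields a factor b by scaling, and [flat_powR] absorbs the powers of 1/r. The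
    constant is uniform in b because |b t| <= 1 on the support. *)
Lemma derive_bump_le (th : R) : 0 < th < 1 -> exists2 C : R, 0 < C &
  forall b t : R, 0 < b ->
  `|derive1n 1 (bump (b ^+ 2)) t| <= C * b * bump (b ^+ 2) t `^ th /\
  `|derive1n 2 (bump (b ^+ 2)) t| <= C * b ^+ 2 * bump (b ^+ 2) t `^ th.
Proof.
move=> th01; have [C1 C10 H1] := flat_powR 2 th01; have [C2 C20 H2] := flat_powR 4 th01.
(* The 2 is the coefficient in the first derivative; 14 = 2 + 8 + 4 bounds the polynomial factor of
   the second one when r and (b t)^2 lie in [0, 1]. *)
exists (2 * C1 + 14 * C2); first by lra.
move=> b t b0; rewrite derive1_bump derive2_bump /bump; set r := 1 - _.
have [r0|r0] := leP r 0.
  rewrite !(flat_le0 _ r0) !mulr0 normr0.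
  by split; rewrite mulr_ge0 ?powR_ge0// mulr_ge0 ?exprn_ge0 ?(ltW b0)//; lra.
have p0 := powR_ge0 (flat 0 r) th.
have bt : `|b * t| <= 1.
  rewrite -ler_sqr ?nnegrE// real_normK ?num_real// expr1n exprMn.
  by move: r0; rewrite /r; lra.
have bt2 : 0 <= (b * t) ^+ 2 <= 1.
  by rewrite sqr_ge0 -real_normK ?num_real//= exprn_ile1.
split; rewrite normrM (ger0_norm (flat_ge0 _ _)).
  apply: (@le_trans _ _ (2 * b * (C1 * flat 0 r `^ th))).
    apply: ler_pM; rewrite ?flat_ge0 ?H1//.
    rewrite normrN; have -> : 2 * b ^+ 2 * t = (2 * b) * (b * t) by ring.
    by rewrite normrM gtr0_norm ?mulr_gt0// ler_piMr// mulr_ge0// ltW.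
  rewrite mulrA ler_wpM2r//; nra.
rewrite normrM (ger0_norm (sqr_ge0 b)).
apply: (@le_trans _ _ (b ^+ 2 * 14 * (C2 * flat 0 r `^ th))).
  apply: ler_pM; rewrite ?flat_ge0 ?H2 ?(ltW b0)// ?mulr_ge0 ?sqr_ge0 ?(ltW b0)//.
  rewrite ler_wpM2l ?sqr_ge0//.
  have -> : 8 * b ^+ 2 * t ^+ 2 * r = 8 * (b * t) ^+ 2 * r by ring.
  have -> : b ^+ 2 * t ^+ 2 = (b * t) ^+ 2 by ring.
  have -> : r = 1 - (b * t) ^+ 2 by rewrite /r; ring.
  move: ((b * t) ^+ 2) bt2 => y /andP[y0 y1].
  by rewrite ler_norml; apply/andP; split; nra.
rewrite mulrA ler_wpM2r//.
have : 0 <= b ^+ 2 by rewrite sqr_ge0.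
by move: (b ^+ 2) => y y0; nra.
Qed.

End bounds.

(** * Products of one-variable functions of the coordinates *)

Section product.
Context {R : realType} {n : nat}.
Implicit Types (g : 'I_n -> R -> R) (x : 'rV[R]_n).

Definition tensor g x : R := \prod_(i < n) g i (x ord0 i).

Definition set_factor g (i : 'I_n) (f : R -> R) : 'I_n -> R -> R :=
  fun j => if j == i then f else g j.

(** Reduces a directional derivative to the one-variable rules. *)
Lemma is_derive_line (V : normedModType R) (f : V -> R) (x v : V) (d : R) :
  is_derive (0 : R) (1 : R) (fun h : R => f (h *: v + x)) d -> is_derive x v f d.
Proof.
move=> [df d0]; split; first by have [_] := derivable1P f x v; apply.
rewrite -d0 /derive; set g1 := fun h => h^-1 *: _; set g2 := fun h => h^-1 *: _.
suff -> : g1 = g2 by [].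
by apply/funext => h; rewrite /g1 /g2 /= addr0 scale0r add0r [_%:A]mulr1.
Qed.

(** Along the i-th axis every other factor is constant, so the derivative is again a tensor and the
    step can be iterated. *)
Lemma is_derive_tensor g (i : 'I_n) x : derivable (g i) (x ord0 i) 1 ->
  is_derive x (delta_mx ord0 i) (tensor g)
    (tensor (set_factor g i (derive1 (g i))) x).
Proof.
move=> dg; apply: is_derive_line.
pose C := \prod_(j < n | j != i) g j (x ord0 j).
have E : (fun h : R => tensor g (h *: delta_mx ord0 i + x)) =
    (fun h => C *: g i (h + x ord0 i)).
  apply/funext => h; rewrite /tensor (bigD1 i)//= !mxE !eqxx /= mulr1 mulrC /C.
  congr (_ * _); apply: eq_bigr => j ji.
  by rewrite !mxE (negbTE ji) andbF mulr0 add0r.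
rewrite E.
have -> : tensor (set_factor g i (derive1 (g i))) x = C *: derive1 (g i) (x ord0 i).
  rewrite /tensor (bigD1 i)//= /set_factor eqxx mulrC; congr (_ * _).
  by apply: eq_bigr => j /negbTE ->.
apply: is_deriveZ.
have dg' : is_derive (0 + x ord0 i) 1 (g i) (derive1 (g i) (x ord0 i)).
  by rewrite add0r derive1E; exact: derivableP.
apply: (is_derive_eq (@is_derive1_comp R (g i) (shift (x ord0 i)) 0 _ _ dg'
  (is_derive_shift 0 1 (x ord0 i)))).
by rewrite mulr1.
Qed.

Lemma continuous_tensor g : (forall i, continuous (g i)) -> continuous (tensor g).
Proof.
move=> cg; rewrite /tensor; elim: (index_enum _) => [|i s IH].
  rewrite (_ : (fun x => _) = cst 1); first exact: cst_continuous.
  by apply/funext => x; rewrite big_nil.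
rewrite (_ : (fun x => _) =
  (fun x => g i (x ord0 i)) \* (fun x => \prod_(j <- s) g j (x ord0 j))).
  move=> x; apply: continuousM; last exact: IH.
  exact: (cvg_comp _ _ (@coord_continuous R _ _ ord0 i x) (cg i (x ord0 i))).
by apply/funext => x; rewrite big_cons.
Qed.

Lemma partials_tensor (g : R -> R) (s : seq 'I_n) :
  (forall k t, derivable (derive1n k g) t 1) ->
  partials s (tensor (fun=> g)) = tensor (fun i => derive1n (count_mem i s) g).
Proof.
move=> dg; elim: s => [|i s IH] //=; rewrite IH; apply/funext => x.
rewrite /partial.
rewrite (@derive_val _ _ _ _ _ _ _ (@is_derive_tensor _ i x (dg _ _))).
apply: eq_bigr => j _; rewrite /set_factor; by have [->|] := eqVneq j i.
Qed.

Lemma smooth_tensor (g : R -> R) : (forall k t, derivable (derive1n k g) t 1) ->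
  smooth (tensor (fun=> g)).
Proof.
move=> dg s; rewrite partials_tensor//; split.
  apply: continuous_tensor => i t.
  exact/differentiable_continuous/derivable1_diffP.
by move=> i x; apply: (@ex_derive _ _ _ _ _ _ _ (@is_derive_tensor _ i x (dg _ _))).
Qed.

Lemma laplacian_tensor (g : R -> R) x : (forall k t, derivable (derive1n k g) t 1) ->
  laplacian (tensor (fun=> g)) x =
  \sum_(i < n) tensor (set_factor (fun=> g) i (derive1n 2 g)) x.
Proof.
move=> dg; apply: eq_bigr => i _.
have -> : partial i (partial i (tensor (fun=> g))) = partials [:: i; i] (tensor (fun=> g)).
  by [].
rewrite partials_tensor//; apply: eq_bigr => j _; rewrite /set_factor.
by rewrite /= eq_sym; case: eqP.
Qed.

(** The support lies in a cube, which is compact as a product of segments and closed, so it contains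
    the closure. *)
Lemma test_function_tensor (g : R -> R) (r : R) :
  (forall k t, derivable (derive1n k g) t 1) ->
  (forall t, r <= `|t| -> g t = 0) -> test_function (tensor (fun=> g)).
Proof.
move=> dg g0; split; first exact: smooth_tensor.
pose K : set 'rV[R]_n := [set x | forall i, `[- r, r]%classic (x ord0 i)].
have cK : compact K.
  by apply: (@rV_compact R n (fun=> `[- r, r]%classic)) => i; exact: segment_compact.
apply: (subclosed_compact _ cK); first exact: closed_closure.
have clK : closed K by apply: compact_closed => //; exact: norm_hausdorff.
rewrite [X in _ `<=` X](closure_id K).1//; apply: closureS => x /= hx i.
rewrite /= in_itv/= -ler_norml leNgt; apply/negP => /ltW/g0 h.
by move/eqP: hx; apply; rewrite /tensor (bigD1 i)//= h mul0r.
Qed.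

End product.

(** * Lebesgue measure and Euclidean norm on R^n *)

Section measure.
Context {R : realType} {n : nat}.
Implicit Types (x y : 'rV[R]_n) (r : R).

(** Cubes fit both the product measure and the supports of tensor cutoffs better than Euclidean
    balls. *)
Definition box r : set 'rV[R]_n := [set x | forall i, `[- r, r]%classic (x ord0 i)].

Lemma boxP r x : box r x <-> forall i, `|x ord0 i| <= r.
Proof.
by split=> h i; have := h i; rewrite /= in_itv/= ler_norml.
Qed.

Lemma measurable_box r : measurable (box r).
Proof.
rewrite (_ : box r = \bigcap_(i in [set: 'I_n])
   ((fun x : 'rV[R]_n => x ord0 i : measurableTypeR R) @^-1` `[- r, r])).
  apply: fin_bigcap_measurable => // i _.
  rewrite -[X in measurable X]setTI.
  exact: (measurable_rV_coord i measurableT (measurable_itv _)).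
by apply/seteqP; split=> x /= h i; [move=> _|]; exact: h.
Qed.

Lemma measurable_rV_set1 x : measurable [set x].
Proof.
rewrite (_ : [set x] = \bigcap_(i in [set: 'I_n])
   ((fun x : 'rV[R]_n => x ord0 i : measurableTypeR R) @^-1` [set x ord0 i])).
  apply: fin_bigcap_measurable => // i _.
  rewrite -[X in measurable X]setTI.
  exact: (measurable_rV_coord i measurableT (measurable_set1 _)).
by apply/seteqP; split=> [y ->//|y h]; apply/rowP => i; exact: h.
Qed.

Lemma lebesgue_box r : 0 <= r -> lebesgue_rV n (box r) = ((2 * r) ^+ n)%:E.
Proof.
move=> r0; rewrite (@lebesgue_rV_box R n (fun=> `[- r, r]%classic)); last first.
  by move=> i; exact: measurable_itv.
rewrite (eq_bigr (fun=> (2 * r)%:E)); last first.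
  move=> i _; rewrite lebesgue_measure_itv/= lte_fin opprK.
  have [h|h] := ltP; first by rewrite -EFinD; congr (_%:E); ring.
  have -> : r = 0 by lra.
  by rewrite mulr0.
by rewrite prodEFin prodr_const card_ord.
Qed.

Lemma measurable_tensor (g : 'I_n -> R -> R) :
  (forall i, measurable_fun setT (g i)) ->
  measurable_fun setT (tensor g : 'rV[R]_n -> R).
Proof.
move=> mg; rewrite /tensor; elim: (index_enum _) => [|i s IH].
  by under eq_fun do rewrite big_nil; exact: measurable_cst.
under eq_fun do rewrite big_cons; apply: measurable_funM; last exact: IH.
exact: (measurableT_comp (mg i) (measurable_rV_coord i)).
Qed.

Lemma measurable_enorm_sub x : measurable_fun setT (fun y => enorm (x - y)).
Proof.
rewrite /enorm (_ : (fun y => _) = (fun y => dotprod (x - y) (x - y) `^ 2^-1)).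
  apply: (measurableT_comp (@measurable_powR R 2^-1)); rewrite /dotprod.
  elim: (index_enum _) => [|i s IH].
    by under eq_fun do rewrite big_nil; exact: measurable_cst.
  under eq_fun do rewrite big_cons; apply: measurable_funD; last exact: IH.
  have m : measurable_fun setT (fun y => (x - y) ord0 i).
    under eq_fun do rewrite !mxE; apply: measurable_funB => //.
    exact: measurable_rV_coord.
  exact: measurable_funM.
apply/funext => y; rewrite powR12_sqrt// /dotprod sumr_ge0// => i _.
by rewrite -expr2 sqr_ge0.
Qed.

Lemma enorm_ge0 x : 0 <= enorm x. Proof. exact: sqrtr_ge0. Qed.

Lemma enorm_gt0 x : x != 0 -> 0 < enorm x.
Proof.
move=> x0; rewrite /enorm sqrtr_gt0 /dotprod.
have [i xi] : exists i, x ord0 i != 0.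
  apply/existsP; rewrite -negb_forall; apply: contra x0 => /forallP h.
  by apply/eqP/rowP => i; rewrite mxE; exact/eqP.
rewrite (bigD1 i)//= ltr_pwDl//.
  by rewrite -expr2 exprn_even_gt0.
by rewrite sumr_ge0// => j _; rewrite -expr2 sqr_ge0.
Qed.

(** The factor n is cruder than sqrt n but avoids a root: n r^2 <= (n r)^2. *)
Lemma enorm_le r x : (forall i, `|x ord0 i| <= r) -> 0 <= r -> enorm x <= n%:R * r.
Proof.
move=> h r0; rewrite /enorm.
have nr : 0 <= n%:R * r by rewrite mulr_ge0.
rewrite -[leRHS]ger0_norm// -sqrtr_sqr ler_wsqrtr// /dotprod.
apply: (@le_trans _ _ (\sum_(i < n) r ^+ 2)).
  apply: ler_sum => i _; rewrite -expr2 -[leLHS]real_normK ?num_real//.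
  by rewrite ler_sqr ?nnegrE.
rewrite sumr_const card_ord -[leLHS]mulr_natl exprMn ler_wpM2r ?sqr_ge0//.
rewrite -natrX ler_nat; case: (n) => // m.
by rewrite expnS expn1 leq_pmull.
Qed.

(** The dimension must be positive: for n = 0 the measure is a unit mass at the only point. *)
Lemma lebesgue_rV_set1 x : (0 < n)%N -> lebesgue_rV n [set x] = 0%E.
Proof.
move=> n0.
have -> : [set x] = [set y | forall i, [set x ord0 i] (y ord0 i)].
  by apply/seteqP; split=> [y ->//|y h]; apply/rowP => i; exact: h.
rewrite (@lebesgue_rV_box R n (fun i => [set x ord0 i])).
  rewrite (bigD1 (Ordinal n0))//=.
  by rewrite lebesgue_measure_set1 mul0e.
by move=> i; exact: measurable_set1.
Qed.

End measure.

(** * Cutoffs and the integral estimates *)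

Section weight.
Context {R : realType}.

(** Young's inequality without the sharp constant: either a <= l v^(p-1) and the first term
    suffices, or v <= (a/l)^(1/(p-1)) and the second one does. *)
Lemma young_shift (p a v l : R) : 1 < p -> 0 <= a -> 0 <= v -> 0 < l ->
  a * v <= l * v `^ p + a * (a / l) `^ (p - 1)^-1.
Proof.
move=> p1 a0 v0 l0; have p10 : 0 < p - 1 by rewrite subr_gt0.
have [h|/ltW h] := leP a (l * v `^ (p - 1)).
  apply: (@le_trans _ _ (l * v `^ p)).
    rewrite -(mulr_powRB1 v0 (lt_trans ltr01 p1)) [leRHS]mulrCA [leLHS]mulrC.
    by rewrite ler_wpM2l.
  by rewrite lerDl mulr_ge0// powR_ge0.
apply: (@le_trans _ _ (a * (a / l) `^ (p - 1)^-1)); last first.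
  by rewrite lerDr mulr_ge0// ?powR_ge0// ltW.
rewrite ler_wpM2l//.
rewrite [leLHS](_ : v = (v `^ (p - 1)) `^ (p - 1)^-1); last first.
  by rewrite -powRrM mulfV ?gt_eqF// powRr1.
apply: ge0_ler_powR; rewrite ?nnegrE ?powR_ge0 ?divr_ge0 ?(ltW l0)//.
  by rewrite invr_ge0 ltW.
by rewrite ler_pdivlMr// mulrC.
Qed.

Lemma le_powR_self (a th : R) : 0 <= a <= 1 -> th <= 1 -> a <= a `^ th.
Proof.
move=> /andP[a0 a1] th1; have [->|an0] := eqVneq a 0; first exact: powR_ge0.
by apply: ger1_powR => //; rewrite lt_neqAle eq_sym an0 a0.
Qed.

Context {n : nat}.
Implicit Types (x : 'rV[R]_n) (t r b : R).

(** The parameters have the form [b ^+ 2] with b = 1/r in space and b = 1/r^2 in time, so the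
    supports form the parabolic cylinder |x_i| <= r, |t| <= r^2. *)
Definition space_cutoff r x : R := tensor (fun=> bump (r^-1 ^+ 2)) x.
Definition time_cutoff r t : R := bump ((r^-1 ^+ 2) ^+ 2) t.

Lemma tensor_powR (g : 'I_n -> R -> R) (th : R) x :
  (forall i t, 0 <= g i t) -> tensor g x `^ th = tensor (fun i t => g i t `^ th) x.
Proof.
move=> g0; rewrite /tensor; elim: (index_enum _) => [|i s IH].
  by rewrite !big_nil powR1.
by rewrite !big_cons powRM ?IH// prodr_ge0.
Qed.

Lemma space_cutoff_itv r x : 0 <= space_cutoff r x <= 1.
Proof.
rewrite /space_cutoff /tensor prodr_ge0/=; last by move=> *; exact: bump_ge0.
by apply: prodr_ile1 => i _; rewrite bump_ge0 bump_le1.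
Qed.

Lemma time_cutoff_itv r t : 0 <= time_cutoff r t <= 1.
Proof. by rewrite bump_ge0 bump_le1. Qed.

Lemma space_cutoff_box r x : 0 < r -> space_cutoff r x != 0 -> box r x.
Proof.
move=> r0 h; apply/boxP => i; rewrite leNgt; apply/negP => /ltW xi.
move/eqP: h; apply; rewrite /space_cutoff /tensor (bigD1 i)//= bump_eq0 ?mul0r//.
  by rewrite invr_gt0.
by rewrite invrK.
Qed.

Lemma time_cutoff_itv0 r t : 0 < r -> time_cutoff r t != 0 -> `|t| <= r ^+ 2.
Proof.
move=> r0 h; rewrite leNgt; apply/negP => /ltW xi.
move/eqP: h; apply; rewrite /time_cutoff bump_eq0 ?mul0r//.
  by rewrite exprn_gt0// invr_gt0.
by rewrite exprVn invrK.
Qed.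

Lemma space_cutoff_ge r x : 0 < r -> box (r / 2) x ->
  flat 0 (3 / 4) ^+ n <= space_cutoff r x.
Proof.
move=> r0 /boxP h; rewrite /space_cutoff /tensor.
rewrite -[X in _ ^+ X]card_ord -prodr_const; apply: ler_prod => i _.
rewrite flat_ge0/=; apply: bump_ge; first by rewrite invr_gt0.
by rewrite invfM invrK mulrC.
Qed.

Lemma test_function_space_cutoff r : 0 < r -> test_function (space_cutoff r).
Proof.
move=> r0; apply: (@test_function_tensor _ _ _ r); first exact: derivable_bump.
by move=> t h; apply: bump_eq0; rewrite ?invr_gt0// invrK.
Qed.

Lemma time_test_function_cutoff r : 0 < r -> time_test_function +oo%E (time_cutoff r).
Proof.
move=> r0; split; first exact: derivable_bump.
exists (r ^+ 2); split; first by rewrite /time_itv/= ltry sqr_ge0.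
move=> t rt; apply: bump_eq0; first by rewrite exprn_gt0// invr_gt0.
by rewrite exprVn invrK; apply: le_trans (ler_norm _); exact: ltW.
Qed.

Lemma time_cutoff0 r : time_cutoff r 0 = flat 0 1.
Proof. by rewrite /time_cutoff /bump expr0n/= mulr0 subr0. Qed.

(** The bump is even. Hence the term with u0 alone drops out of the weak identity and only u0 + u1
    remains. *)
Lemma derive1_time_cutoff0 r : derive1 (time_cutoff r) 0 = 0.
Proof. by rewrite -derive1n1 derive1_bump mulr0 oppr0 mul0r. Qed.

(** In each summand one factor is differentiated and bounded by its power th; the others lie in
    [0, 1], so they are at most their own power th. *)
Lemma laplacian_cutoff_le (th C b : R) x : 0 < b -> th <= 1 ->
  (forall t, `|derive1n 2 (bump (b ^+ 2)) t| <= C * b ^+ 2 * bump (b ^+ 2) t `^ th) ->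
  `|laplacian (tensor (fun=> bump (b ^+ 2))) x| <=
  n%:R * (C * b ^+ 2 * tensor (fun=> bump (b ^+ 2)) x `^ th).
Proof.
move=> b0 th1 H; rewrite laplacian_tensor; last exact: derivable_bump.
apply: le_trans (ler_norm_sum _ _ _) _.
rewrite mulr_natl -[X in _ *+ X]card_ord -sumr_const; apply: ler_sum => i _.
rewrite tensor_powR; last by move=> *; exact: bump_ge0.
rewrite /tensor (bigD1 i)//= [in leRHS](bigD1 i)//= /set_factor eqxx normrM mulrA.
apply: ler_pM => //; first exact: H.
rewrite normr_prod; apply: ler_prod => j /negbTE ->.
rewrite ger0_norm ?bump_ge0//=; apply: le_powR_self => //.
by rewrite bump_ge0 bump_le1.
Qed.

(** The first time derivative and the Laplacian are of order r^-2; the second time derivative is of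
    order r^-4, which is smaller as r >= 1. *)
Lemma weight_le (th : R) : 0 < th < 1 -> exists2 C : R, 0 < C &
  forall r t x, 1 <= r ->
  `|space_cutoff r x * derive1n 2 (time_cutoff r) t
    - space_cutoff r x * derive1 (time_cutoff r) t
    - time_cutoff r t * laplacian (space_cutoff r) x|
  <= C * r^-1 ^+ 2 * (space_cutoff r x * time_cutoff r t) `^ th.
Proof.
move=> th01; have [C C0 H] := derive_bump_le th01.
have th1 : th <= 1 by case/andP: th01 => _ /ltW.
(* The n counts the summands of the Laplacian, the 2 the two time derivatives. *)
exists ((n%:R + 2) * C); first by rewrite mulr_gt0// ltr_wpDl.
move=> r t x r1; have r0 : 0 < r by apply: lt_le_trans r1.
have b0 : 0 < r^-1 by rewrite invr_gt0.
have b1 : 0 < r^-1 ^+ 2 <= 1.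
  by rewrite exprn_gt0//= exprn_ile1// ?invf_le1// ltW.
have [/andP[b20 b21]] := b1.
have [Ht1 Ht2] := H _ t b20; rewrite derive1n1 in Ht1.
have := laplacian_cutoff_le x b0 th1 (fun t => (H _ t b0).2).
have /andP[s0 s1] := space_cutoff_itv r x; have /andP[c0 c1] := time_cutoff_itv r t.
have sth : space_cutoff r x <= space_cutoff r x `^ th.
  by apply: le_powR_self => //; rewrite s0.
have cth : time_cutoff r t <= time_cutoff r t `^ th.
  by apply: le_powR_self => //; rewrite c0.
rewrite -/(space_cutoff r) powRM//.
have p1 := powR_ge0 (space_cutoff r x) th; have p2 := powR_ge0 (time_cutoff r t) th.
rewrite -/(time_cutoff r) -/(space_cutoff r x) in Ht1 Ht2 *.
move: (laplacian _ _) => L HL.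
apply: le_trans (ler_normB _ _) _.
apply: (@le_trans _ _ (`|space_cutoff r x * derive1n 2 (time_cutoff r) t| +
   `|space_cutoff r x * derive1 (time_cutoff r) t| + `|time_cutoff r t * L|)).
  by rewrite lerD2r ler_normB.
rewrite !normrM (ger0_norm s0) (ger0_norm c0).
move: Ht1 Ht2 HL sth cth p1 p2 s0 c0.
move: (normr_ge0 L) (normr_ge0 (derive1 (time_cutoff r) t)).
move: (normr_ge0 (derive1n 2 (time_cutoff r) t)).
move: `|derive1 _ _| `|derive1n 2 _ _| `|L|.
move: (space_cutoff r x) (space_cutoff r x `^ th).
move: (time_cutoff r t) (time_cutoff r t `^ th).
move: (r^-1 ^+ 2) b20 b21 => b b20 b21 c cp s sp d1 d2 l.
move=> d20 l0 d10 Ht1 Ht2 HL sth cth p1 p2 s0 c0.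
have Cb : 0 <= C * b by apply: mulr_ge0; exact: ltW.
have h1 : s * d1 <= C * b * (sp * cp).
  by rewrite mulrCA; exact: ler_pM.
have h2 : s * d2 <= C * b * (sp * cp).
  rewrite mulrCA; apply: ler_pM => //; apply: (le_trans Ht2).
  apply: ler_wpM2r => //; apply: ler_wpM2l; first exact: ltW.
  by rewrite expr2; apply: ler_piMr => //; exact: ltW.
have h3 : c * l <= n%:R * (C * b * (sp * cp)).
  have -> : n%:R * (C * b * (sp * cp)) = cp * (n%:R * (C * b * sp)) by ring.
  exact: ler_pM.
have -> : (n%:R + 2) * C * b * (sp * cp) =
  C * b * (sp * cp) + C * b * (sp * cp) + n%:R * (C * b * (sp * cp)) by ring.
by apply: lerD => //; apply: lerD.
Qed.

End weight.

(** * Lower bound for the nonlocal source *)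

Section source.
Context {R : realType} {n : nat}.
Implicit Types (x y : 'rV[R]_n) (t r : R).
Local Notation mu := (@lebesgue_rV R n).
Local Notation stm := (@space_time_measure R n).
Local Notation D := (@space_time R n +oo%E).

Lemma time_itvy : @time_itv R +oo%E = `[0, +oo[%classic.
Proof.
by apply/seteqP; split=> t; rewrite /time_itv/= in_itv/= andbT ltry; [case|].
Qed.

Lemma measurable_space_time : measurable D.
Proof.
by apply: measurableX => //; rewrite time_itvy; exact: measurable_itv.
Qed.

Lemma measurable_space_cutoff r :
  measurable_fun setT (space_cutoff r : 'rV[R]_n -> R).
Proof.
apply: measurable_tensor => i; apply: continuous_measurable_fun => t.
apply/differentiable_continuous/derivable1_diffP.
by have := @derivable_bump R (r^-1 ^+ 2) 0 t.
Qed.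

Lemma measurable_time_cutoff r : measurable_fun setT (time_cutoff r).
Proof.
apply: continuous_measurable_fun => t.
apply/differentiable_continuous/derivable1_diffP.
by have := @derivable_bump R ((r^-1 ^+ 2) ^+ 2) 0 t.
Qed.

(** The cube of half side r/2 has volume r^n, and there each of the n factors is at least
    [flat 0 (3 / 4)]. *)
Lemma integral_space_cutoff_ge r : 0 < r ->
  ((flat 0 (3 / 4) ^+ n * r ^+ n)%:E <= \int[mu]_x (space_cutoff r x)%:E)%E.
Proof.
move=> r0.
have mphi : measurable_fun setT (fun x => (space_cutoff r x)%:E).
  by apply/measurable_EFinP; exact: measurable_space_cutoff.
have phi0 x : (0 <= (space_cutoff r x)%:E)%E.
  by rewrite lee_fin; case/andP: (space_cutoff_itv r x).
apply: (@le_trans _ _ (\int[mu]_(x in box (r / 2)) (space_cutoff r x)%:E)%E); last first.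
  by apply: ge0_subset_integral => //; exact: measurable_box.
apply: (@le_trans _ _ (\int[mu]_(x in box (r / 2)) (flat 0 (3 / 4) ^+ n)%:E)%E).
  rewrite integral_cst; last exact: measurable_box.
  rewrite [X in (_ * X)%E](_ : _ = (r ^+ n)%:E); first by rewrite -EFinM.
  have r20 : 0 <= r / 2 by rewrite divr_ge0// ltW.
  by apply: (etrans (lebesgue_box r20)); rewrite mulrCA divff ?mulr1.
apply: ge0_le_integral => //; first exact: measurable_box.
- by move=> x _; rewrite lee_fin exprn_ge0// flat_ge0.
- exact: measurable_funTS.
- by move=> x hx; rewrite lee_fin space_cutoff_ge.
Qed.

(* The kernel is 0 instead of +oo at y = x, since 0 `^ (- s) = 0, so the pointwise
   lower bound on it only holds almost everywhere. *)
Lemma kernel_integral_ge (s r : R) x (f g : 'rV[R]_n -> R) :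
  (0 < n)%N -> 0 <= s -> 0 < r -> box r x ->
  measurable_fun setT f -> (forall y, 0 <= f y) ->
  measurable_fun setT g -> (forall y, 0 <= g y <= 1) ->
  (forall y, g y != 0 -> box r y) ->
  (((2 * n%:R * r) `^ (- s))%:E * \int[mu]_y (f y * g y)%:E <=
  \int[mu]_y (enorm (x - y) `^ (- s) * f y)%:E)%E.
Proof.
move=> n0 s0 r0 hx mf f0 mg g01 gB.
have fg0 y : 0 <= f y * g y by rewrite mulr_ge0//; case/andP: (g01 y).
have mfg : measurable_fun setT (fun y => (f y * g y)%:E).
  by apply/measurable_EFinP; exact: measurable_funM.
rewrite -ge0_integralZl_EFin//; last 2 first.
- by move=> y _; rewrite lee_fin.
- exact: powR_ge0.
apply: ae_ge0_le_integral => //.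
- by move=> y _; rewrite -EFinM lee_fin mulr_ge0// powR_ge0.
- exact: measurable_funeM.
- by move=> y _; rewrite lee_fin mulr_ge0// powR_ge0.
- apply/measurable_EFinP; apply: measurable_funM => //.
  exact: (measurableT_comp (@measurable_powR R (- s)) (measurable_enorm_sub x)).
exists [set x]; split; [exact: measurable_rV_set1|exact: lebesgue_rV_set1|].
move=> y /= h; apply: contrapT => yx; apply: h => _.
rewrite -EFinM lee_fin; have [g0|gn0] := eqVneq (g y) 0.
  by rewrite g0 !mulr0 mulr_ge0// powR_ge0.
apply: ler_pM => //; first exact: powR_ge0.
  have e0 : 0 < enorm (x - y).
    by apply: enorm_gt0; rewrite subr_eq0; apply/eqP => xy; apply: yx.
  have n0' : 0 < n%:R :> R by rewrite ltr0n.
  rewrite !powRN lef_pV2 ?posrE ?powR_gt0 ?mulr_gt0//.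
  apply: ge0_ler_powR => //; rewrite ?nnegrE ?(ltW e0) ?mulr_ge0 ?(ltW r0)//.
  (* Coordinates of two points of the cube differ by at most 2 r, so their Euclidean distance is at
     most 2 n r. *)
  rewrite (_ : 2 * n%:R * r = n%:R * (2 * r)); last by ring.
  apply: enorm_le; last by rewrite mulr_ge0// ltW.
  move=> i; rewrite !mxE; apply: (le_trans (ler_normB _ _)).
  have := (boxP r x).1 hx i; have := (boxP r y).1 (gB y gn0) i; lra.
by rewrite ler_piMr//; case/andP: (g01 y).
Qed.

Local Notation weighted f r := (fun z : measurableTypeR R * 'rV[R]_n =>
  (f z.1 z.2 * (space_cutoff r z.2 * time_cutoff r z.1))%:E).

Lemma measurable_weighted (f : R -> 'rV[R]_n -> R) r :
  measurable_fun D (fun z => f z.1 z.2) -> measurable_fun D (weighted f r).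
Proof.
move=> mf; apply/measurable_EFinP; apply: measurable_funM => //.
apply: measurable_funTS; apply: measurable_funM.
  exact: (measurableT_comp (measurable_space_cutoff r) measurable_snd).
exact: (measurableT_comp (measurable_time_cutoff r) measurable_fst).
Qed.

(** Measurability is only known on the half-space, so the section is taken of the extension by 0. *)
Lemma measurable_section (f : R -> 'rV[R]_n -> R) t :
  measurable_fun D (fun z => f z.1 z.2) -> 0 <= t -> measurable_fun setT (f t).
Proof.
move=> mf t0; have mD := measurable_space_time.
have m := (measurable_restrictT _ mD).1 mf.
apply: (eq_measurable_fun (((fun z => f z.1 z.2) \_ D) \o pair t)) => [x _|].
  by rewrite /= patchE ifT// inE; split => //; rewrite /time_itv/= ltry.
exact: (measurableT_comp m (measurable_pair1 t)).
Qed.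

(** The kernel bound replaces the source by a product of a function of x and a function of t. By
    Tonelli the x-integral then contributes the mass of the cutoff, of order r^n, and the t-integral
    the weighted integral of f. *)
Lemma riesz_source_ge (s C r : R) (f : R -> 'rV[R]_n -> R) :
  (0 < n)%N -> 0 <= s -> 0 <= C -> 0 < r -> (forall t x, 0 <= f t x) ->
  measurable_fun D (fun z => f z.1 z.2) ->
  let src (z : measurableTypeR R * 'rV[R]_n) : \bar R :=
    (C%:E * \int[mu]_y (enorm (z.2 - y) `^ (- s) * f z.1 y)%:E
     * (space_cutoff r z.2 * time_cutoff r z.1)%:E)%E in
  measurable_fun D src ->
  ((C * (2 * n%:R * r) `^ (- s) * (flat 0 (3 / 4) ^+ n * r ^+ n))%:E
   * \int[stm]_(z in D) weighted f r z <= \int[stm]_(z in D) src z)%E.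
Proof.
move=> n0 s0 C0 r0 f0 mf src msrc.
have mD := measurable_space_time.
have phi01 := @space_cutoff_itv R n r; have chi01 := @time_cutoff_itv R r.
have phi0 x : 0 <= space_cutoff r x by case/andP: (phi01 x).
have chi0 t : 0 <= time_cutoff r t by case/andP: (chi01 t).
pose w := weighted f r \_ D.
have mw : measurable_fun setT w.
  exact: (measurable_restrictT _ mD).1 (@measurable_weighted f r mf).
have w0 z : (0 <= w z)%E.
  by apply: erestrict_ge0 => y _; rewrite lee_fin !mulr_ge0.
pose H := fubini_F (lebesgue_rV n) w.
have mH : measurable_fun setT H by exact: measurable_fun_fubini_tonelli_F.
have H0 t : (0 <= H t)%E by apply: integral_ge0 => y _; exact: w0.
pose K := C * (2 * n%:R * r) `^ (- s).
have K0 : 0 <= K by rewrite mulr_ge0// powR_ge0.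
have HE t : 0 <= t ->
    H t = ((time_cutoff r t)%:E * \int[mu]_y (f t y * space_cutoff r y)%:E)%E.
  move=> t0; rewrite -ge0_integralZl_EFin//; last 2 first.
  - by move=> y _; rewrite lee_fin mulr_ge0.
  - apply/measurable_EFinP; apply: measurable_funM; first exact: measurable_section.
    exact: measurable_space_cutoff.
  apply: eq_integral => y _; rewrite /w patchE ifT.
    by rewrite -EFinM/=; congr (_%:E); ring.
  by rewrite inE; split => //; rewrite /time_itv/= ltry.
have HN t : ~ 0 <= t -> H t = 0%E.
  move=> t0; apply: integral0_eq => y _; rewrite /w patchE ifF//.
  by apply/negP; rewrite inE => -[[]].
(* The minorant with separated variables; [H] is the space integral of the weighted f at a given
   time. *)
pose g (z : measurableTypeR R * 'rV[R]_n) := ((K * space_cutoff r z.2)%:E * H z.1)%E.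
have mg : measurable_fun setT g.
  apply: emeasurable_funM; last exact: (measurableT_comp mH measurable_fst).
  apply/measurable_EFinP; apply: measurable_funM => //.
  exact: (measurableT_comp (measurable_space_cutoff r) measurable_snd).
have g0 z : (0 <= g z)%E by rewrite mule_ge0// lee_fin mulr_ge0.
apply: (@le_trans _ _ (\int[stm]_(z in D) g z)%E); last first.
  apply: ge0_le_integral => //; first exact: measurable_funTS.
  move=> [t x] [[t0 _] _]; rewrite /g /src/= in t0 *.
  (* Outside the support both sides are 0, even where the Riesz integral is +oo, because 0 * oo = 0.
     So the kernel bound is only needed for x in the cube. *)
  have [p0|pn0] := eqVneq (space_cutoff r x) 0.
    by rewrite p0 mulr0 mul0r mul0e mule0.
  have hx := space_cutoff_box r0 pn0.
  have mft := measurable_section mf t0.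
  have := kernel_integral_ge n0 s0 r0 hx mft (f0 t) (measurable_space_cutoff r)
    phi01 (fun y => @space_cutoff_box R n r y r0).
  rewrite HE// /K; move: (\int[_]_y _)%E (\int[_]_y _)%E => J I IJ.
  rewrite [leRHS]muleC [leRHS]muleA -[in leRHS]EFinM.
  have -> : ((C * (2 * n%:R * r) `^ (- s) * space_cutoff r x)%:E *
     ((time_cutoff r t)%:E * I) =
     (space_cutoff r x * time_cutoff r t * C)%:E * (((2 * n%:R * r) `^ (- s))%:E * I))%E.
    by rewrite !muleA -!EFinM; congr (_%:E * _)%E; ring.
  by apply: lee_wpmul2l => //; rewrite lee_fin !mulr_ge0.
have -> : (\int[stm]_(z in D) weighted f r z = \int[stm]_z w z)%E.
  by rewrite [LHS]integral_mkcond.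
have -> : (\int[stm]_(z in D) g z = \int[stm]_z g z)%E.
  rewrite [LHS]integral_mkcond; apply: eq_integral => -[t x] _.
  rewrite patchE; case: ifPn => //; rewrite notin_setE => h.
  rewrite /g/= HN ?mule0// => t0; apply: h; split => //.
  by rewrite /time_itv/= ltry.
rewrite /space_time_measure (fubini_tonelli1 _ mw w0) (fubini_tonelli1 _ mg g0).
rewrite -/H.
pose J := (\int[mu]_x (space_cutoff r x)%:E)%E.
have gE t : (fubini_F (lebesgue_rV n) g t = K%:E * J * H t)%E.
  rewrite /fubini_F /g/= ge0_integralZr//; last 2 first.
  - apply/measurable_EFinP; apply: measurable_funM => //.
    exact: measurable_space_cutoff.
  - by move=> x _; rewrite lee_fin mulr_ge0.
  congr (_ * _)%E; rewrite -ge0_integralZl_EFin//.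
  - by move=> x _; rewrite lee_fin.
  - by apply/measurable_EFinP; exact: measurable_space_cutoff.
under [leRHS]eq_integral do rewrite gE.
have J0 : (0 <= J)%E by apply: integral_ge0 => x _; rewrite lee_fin.
rewrite ge0_integralZl//; last by rewrite mule_ge0// lee_fin.
rewrite lee_wpmul2r//; first by apply: integral_ge0 => t _.
by rewrite EFinM lee_wpmul2l ?lee_fin// integral_space_cutoff_ge.
Qed.

End source.

(** * The blow-up argument *)

Section main.
Context {R : realType} {n : nat}.
Implicit Types (x y : 'rV[R]_n) (t r : R).
Local Notation mu := (@lebesgue_rV R n).
Local Notation stm := (@space_time_measure R n).
Local Notation D := (@space_time R n +oo%E).
Context (n0 : (0 < n)%N).

Lemma riesz_const_gt0 (gamma : R) : 0 < gamma < n%:R -> 0 < riesz_const n gamma.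
Proof.
move=> /andP[g0 gn]; rewrite /riesz_const divr_gt0//.
  by rewrite Gamma_fun_gt0// divr_gt0// subr_gt0.
by rewrite !mulr_gt0 ?powR_gt0 ?pi_gt0// Gamma_fun_gt0// divr_gt0.
Qed.

(** For gamma = 0 the potential is the identity and k = 1 gives equality. Otherwise r^-(n - gamma)
    from the kernel and r^n from the mass of the cutoff multiply to r^gamma. *)
Lemma source_ge (gamma : R) : 0 <= gamma < n%:R -> exists2 k : R, 0 < k &
  forall r (f : R -> 'rV[R]_n -> R), 0 < r -> (forall t x, 0 <= f t x) ->
  measurable_fun D (fun z => f z.1 z.2) ->
  let src (z : measurableTypeR R * 'rV[R]_n) : \bar R :=
    (riesz gamma (f z.1) z.2 * (space_cutoff r z.2 * time_cutoff r z.1)%:E)%E in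
  measurable_fun D src ->
  ((k * r `^ gamma)%:E *
    \int[stm]_(z in D) (f z.1 z.2 * (space_cutoff r z.2 * time_cutoff r z.1))%:E
   <= \int[stm]_(z in D) src z)%E.
Proof.
move=> /andP[g0 gn]; have [->|gn0] := eqVneq gamma 0.
  exists 1 => // r f r0 f0 mf src msrc.
  rewrite powRr0 mulr1 mul1e le_eqVlt; apply/orP; left; apply/eqP.
  by apply: eq_integral => z _; rewrite /src /riesz eqxx EFinM.
have {}g0 : 0 < gamma by rewrite lt_neqAle eq_sym gn0.
have C0 : 0 < riesz_const n gamma by apply: riesz_const_gt0; rewrite g0.
have n20 : 0 < 2 * n%:R :> R by rewrite mulr_gt0// ltr0n.
exists (riesz_const n gamma * (2 * n%:R) `^ (- (n%:R - gamma)) * flat 0 (3 / 4) ^+ n).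
  apply: mulr_gt0; first by rewrite mulr_gt0 ?powR_gt0.
  by apply/exprn_gt0/flat_gt0; rewrite divr_gt0.
move=> r f r0 f0 mf src msrc.
have gn' : 0 <= n%:R - gamma by rewrite subr_ge0 ltW.
have E : src = fun z => (((riesz_const n gamma)%:E *
    \int[mu]_y (enorm (z.2 - y) `^ (- (n%:R - gamma)) * f z.1 y)%:E)
     * (space_cutoff r z.2 * time_cutoff r z.1)%:E)%E.
  by apply/funext => z; rewrite /src /riesz (negbTE gn0).
have := @riesz_source_ge R n (n%:R - gamma) (riesz_const n gamma) r f n0 gn'
  (ltW C0) r0 f0 mf.
rewrite /= -E => /(_ msrc); apply: le_trans; rewrite le_eqVlt; apply/orP; left.
apply/eqP; congr (_%:E * _)%E.
rewrite (powRM _ (ltW n20) (ltW r0)) -(powR_mulrn n (ltW r0)).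
have -> : r `^ gamma = r `^ (- (n%:R - gamma)) * r `^ n%:R.
  rewrite -powRD; last by rewrite (gt_eqF r0) implybT.
  by congr (_ `^ _); ring.
ring.
Qed.

(** The exponent th = 1/p makes Young's inequality reproduce the source weight: the p-th power of
    |v| s^(1/p) is |v|^p s. *)
Lemma linear_part_le (p : R) : 1 < p -> exists2 C : R, 0 < C &
  forall r l t x (v : R), 1 <= r -> 0 < l ->
  let K := C * r^-1 ^+ 2 * (C * r^-1 ^+ 2 / l) `^ (p - 1)^-1 in
  0 <= t ->
  v * (space_cutoff r x * derive1n 2 (time_cutoff r) t
    - space_cutoff r x * derive1 (time_cutoff r) t
    - time_cutoff r t * laplacian (space_cutoff r) x)
  <= l * (`|v| `^ p * (space_cutoff r x * time_cutoff r t))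
   + K * (\1_(`[0, r ^+ 2]%classic `*` box r) (t, x)).
Proof.
move=> p1; have p0 : 0 < p by apply: lt_trans p1.
have th01 : 0 < p^-1 < 1 by rewrite invr_gt0 p0 invf_lt1.
have [C C0 H] := @weight_le R n _ th01; exists C => // r l t x v r1 l0 K t0.
have r0 : 0 < r by apply: lt_le_trans r1.
have := H r t x r1; move: (_ - _ - _) => W HW.
have a0 : 0 <= C * r^-1 ^+ 2 by rewrite mulr_ge0 ?exprn_ge0 ?invr_ge0 ?(ltW r0)// ltW.
have K0 : 0 <= K by rewrite mulr_ge0// powR_ge0.
have /andP[s0 _] := space_cutoff_itv r x; have /andP[c0 _] := time_cutoff_itv r t.
apply: (le_trans (ler_norm _)); rewrite normrM.
(* Where the product of the cutoffs vanishes, the bound [HW] forces the weight to vanish too. This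
   confines the remainder to the cylinder. *)
have [e|ne] := eqVneq (space_cutoff r x * time_cutoff r t) 0.
  move: HW; rewrite e powR0 ?invr_eq0 ?gt_eqF// mulr0 normr_le0 => /eqP ->.
  by rewrite normr0 !mulr0 add0r mulr_ge0.
have -> : \1_(`[0, r ^+ 2]%classic `*` box r) (t, x) = 1 :> R.
  rewrite indicE mem_set//; split => /=.
    rewrite in_itv/= t0 -(ger0_norm t0) time_cutoff_itv0//.
    by apply: contra_neq ne => ->; rewrite mulr0.
  by apply: space_cutoff_box => //; apply: contra_neq ne => ->; rewrite mul0r.
set s := space_cutoff r x * time_cutoff r t in HW *.
have ss0 : 0 <= s by rewrite mulr_ge0.
have -> : `|v| `^ p * s = (`|v| * s `^ p^-1) `^ p.
  by rewrite powRM ?powR_ge0// -powRrM mulVf ?gt_eqF// powRr1.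
rewrite mulr1; apply: le_trans (young_shift p1 a0 _ l0); last first.
  by rewrite mulr_ge0// powR_ge0.
by rewrite mulrCA ler_wpM2l.
Qed.

(** The remainder is r^-2 (r^-(2 + gamma))^(1/(p-1)) times the volume of the cylinder, of order
    r^(n+2). *)
Lemma weak_solution_bound (gamma p eps : R) (u0 u1 : 'rV[R]_n -> R)
    (u : R -> 'rV[R]_n -> R) :
  0 <= gamma < n%:R -> 1 < p -> global_weak_solution gamma p eps u0 u1 u ->
  exists K : R, forall r, 1 <= r ->
   ((eps * flat 0 1)%:E * \int[mu]_x ((u0 x + u1 x) * space_cutoff r x)%:E
    <= (K * r `^ (n%:R - (2 + gamma) / (p - 1)))%:E)%E.
Proof.
move=> gn p1 [[mu_ _ _] weak].
have p0 : 0 < p by apply: lt_trans p1.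
have [k k0 Hk] := source_ge gn; have [C C0 HC] := linear_part_le p1.
(* C comes from the weight, k from the source bound, and 2^n from the volume of the cube of half
   side r. *)
exists (C * (C / k) `^ (p - 1)^-1 * 2 ^+ n) => r r1.
have r0 : 0 < r by apply: lt_le_trans r1.
have [Isrc Ilin _ _] :=
  weak _ _ (time_test_function_cutoff r0) (test_function_space_cutoff r0).
rewrite time_cutoff0 derive1_time_cutoff0 mulr0 mul0e sube0.
set A := (_%:E * _)%E; set S := (\int[_]_(z in _) _)%E => eqn.
have mD := @measurable_space_time R n.
pose f t x := `|u t x| `^ p.
have f0 t x : 0 <= f t x by exact: powR_ge0.
have mf : measurable_fun D (fun z => f z.1 z.2).
  apply: (measurableT_comp (@measurable_powR R p)).
  exact: (measurableT_comp (@normr_measurable R setT) mu_).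
have := Hk r f r0 f0 mf (measurable_int _ Isrc).
rewrite -/S; set l := k * _; set w := fun z => _ => lS.
have l0 : 0 < l by rewrite mulr_gt0// powR_gt0.
have Sfin : S \is a fin_num by exact: integrable_fin_num.
have mw : measurable_fun D w by exact: measurable_weighted.
have w0 z : (0 <= w z)%E.
  rewrite lee_fin mulr_ge0// mulr_ge0//.
    by case/andP: (space_cutoff_itv r z.2).
  by case/andP: (time_cutoff_itv r z.1).
pose Q : set (measurableTypeR R * 'rV[R]_n) := `[0, r ^+ 2]%classic `*` box r.
have mQ : measurable Q.
  by apply: measurableX; [exact: measurable_itv|exact: measurable_box].
have QE : stm Q = (r ^+ 2 * (2 * r) ^+ n)%:E.
  rewrite /space_time_measure/= product_measure1E//; last exact: measurable_box.
  rewrite EFinM; congr (_ * _)%E; last exact: (lebesgue_box (ltW r0)).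
  by apply: (etrans (lebesgue_measure_itv `[0, r ^+ 2]));
    rewrite /= lte_fin exprn_gt0//= -EFinB subr0.
have QD : Q `<=` D.
  move=> [t x] [/=]; rewrite in_itv/= => /andP[t0 _] _; split => //.
  by rewrite /time_itv/= ltry.
set a := C * r^-1 ^+ 2 in HC.
pose K := a * (a / l) `^ (p - 1)^-1.
have K0 : 0 <= K.
  by rewrite mulr_ge0 ?powR_ge0// mulr_ge0 ?exprn_ge0 ?invr_ge0 ?(ltW r0)// ltW.
have mKQ : measurable_fun D (fun z => (K * \1_Q z)%:E).
  by apply/measurable_EFinP; apply: measurable_funM => //.
have IQ : (\int[stm]_(z in D) (K * \1_Q z)%:E = (K * (r ^+ 2 * (2 * r) ^+ n))%:E)%E.
  under eq_integral do rewrite EFinM.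
  rewrite ge0_integralZl_EFin//; last first.
    by apply/measurable_EFinP; exact: measurable_indic.
  by rewrite integral_indic// setIidl// [X in (_ * X)%E](_ : _ = (r ^+ 2 * (2 * r) ^+ n)%:E).
have mlw : measurable_fun D (fun z => l%:E * w z)%E by exact: measurable_funeM.
(* Integrability of the weighted |u|^p is inherited from the finite source through [lS]. *)
have lw : stm.-integrable D (fun z => l%:E * w z)%E.
  apply/integrableP; split => //.
  under eq_integral do rewrite gee0_abs ?mule_ge0// ?lee_fin ?(ltW l0)//.
  rewrite ge0_integralZl_EFin// ?(ltW l0)//; apply: (le_lt_trans lS).
  by rewrite ltey_eq Sfin.
have KQ : stm.-integrable D (fun z => (K * \1_Q z)%:E).
  apply/integrableP; split => //.
  have KQ0 z : (0 <= (K * \1_Q z)%:E)%E by rewrite lee_fin mulr_ge0// indicE.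
  under eq_integral do rewrite gee0_abs ?KQ0//.
  by rewrite IQ ltry.
have : (S + A <= S + (K * (r ^+ 2 * (2 * r) ^+ n))%:E)%E.
  rewrite eqn; apply: (@le_trans _ _
     (\int[stm]_(z in D) (l%:E * w z + (K * \1_Q z)%:E))%E).
    apply: le_integral => //; first exact: integrableD.
    move=> [t x]; rewrite inE => -[[t0 _] _].
    by rewrite -EFinM -EFinD lee_fin; exact: HC.
  rewrite integralD//; apply: leeD.
    by rewrite ge0_integralZl_EFin// ltW.
  by rewrite IQ.
(* S is finite, so it may be cancelled; what is left is to collect the powers of r. *)
rewrite leeD2lE// => /le_trans; apply; rewrite lee_fin le_eqVlt; apply/orP; left.
apply/eqP; rewrite /K /a /l.
have e2 : r^-1 ^+ 2 = r `^ (-2) by rewrite powRN (powR_mulrn 2 (ltW r0)) exprVn.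
have -> : C * r^-1 ^+ 2 / (k * r `^ gamma) = C / k * r `^ (- (2 + gamma)).
  rewrite opprD powRD ?(gt_eqF r0) ?implybT// e2 !powRN.
  by field; rewrite !gt_eqF ?powR_gt0.
rewrite powRM ?powR_ge0 ?divr_ge0 ?ltW// -powRrM.
rewrite powRD ?(gt_eqF r0) ?implybT// (powR_mulrn n (ltW r0)) mulNr exprMn exprVn.
by field; rewrite gt_eqF.
Qed.

(** As r >= 1, 1 + (n r)^2 <= ((n + 1) r)^2. *)
Lemma japanese_bracket_box r x : 1 <= r -> box (r / 2) x ->
  0 < japanese_bracket x <= (n%:R + 1) * r.
Proof.
move=> r1 hx; rewrite /japanese_bracket.
have e0 := enorm_ge0 x.
have r20 : 0 <= r / 2 by lra.
have e1 := enorm_le ((boxP (r / 2) x).1 hx) r20.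
have nn : 0 <= n%:R :> R by rewrite ler0n.
apply/andP; split; first by rewrite sqrtr_gt0 ltr_wpDr ?sqr_ge0.
have h : 0 <= (n%:R + 1) * r by rewrite mulr_ge0; lra.
rewrite -[leRHS]ger0_norm// -sqrtr_sqr ler_wsqrtr//.
have e2 : enorm x <= n%:R * r by apply: (le_trans e1); rewrite ler_wpM2l//; lra.
have nr : 0 <= n%:R * r by rewrite mulr_ge0//; lra.
have : enorm x ^+ 2 <= (n%:R * r) ^+ 2 by rewrite ler_sqr ?nnegrE.
have : 1 <= r ^+ 2 by rewrite exprn_ege1.
have : 0 <= n%:R * r * r by rewrite mulr_ge0//; lra.
nra.
Qed.

(** The exponent -n + q is not positive, so the upper bound on the bracket gives a lower bound of
    order r^(-n + q) on the cube, whose volume r^n turns it into r^q. *)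
Lemma data_ge (q c r : R) (w : 'rV[R]_n -> R) : q <= n%:R -> 0 < c ->
  (forall x, c * japanese_bracket x `^ (- n%:R + q) <= w x) -> 1 <= r ->
  measurable_fun setT (fun x => (w x * space_cutoff r x)%:E) ->
  ((c * (n%:R + 1) `^ (- n%:R + q) * flat 0 (3 / 4) ^+ n * r `^ q)%:E
    <= \int[mu]_x (w x * space_cutoff r x)%:E)%E.
Proof.
move=> qn c0 Hw r1 mw; have r0 : 0 < r by apply: lt_le_trans r1.
have w0 x : 0 <= w x.
  by apply: le_trans (Hw x); rewrite mulr_ge0 ?powR_ge0 ?ltW.
have phi0 x : 0 <= space_cutoff r x by case/andP: (space_cutoff_itv r x).
have mB : measurable (box (r / 2) : set 'rV[R]_n) by exact: measurable_box.
have c1 : 0 <= flat 0 (3 / 4) ^+ n :> R by rewrite exprn_ge0// flat_ge0.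
apply: (@le_trans _ _
    (\int[mu]_(x in box (r / 2)) (w x * space_cutoff r x)%:E)%E); last first.
  by apply: ge0_subset_integral => // x _; rewrite lee_fin mulr_ge0.
pose m := c * ((n%:R + 1) * r) `^ (- n%:R + q) * flat 0 (3 / 4) ^+ n.
have m0 : 0 <= m by rewrite mulr_ge0// mulr_ge0 ?powR_ge0 ?ltW.
apply: (@le_trans _ _ (\int[mu]_(x in box (r / 2)) m%:E)%E); last first.
  apply: ge0_le_integral => //; first exact: measurable_funTS.
  move=> x hx; rewrite lee_fin; apply: ler_pM => //.
  - by rewrite mulr_ge0 ?powR_ge0 ?ltW.
  - apply: le_trans (Hw x); rewrite ler_wpM2l ?(ltW c0)//.
    have /andP[j0 j1] := japanese_bracket_box r1 hx.
    rewrite (_ : - n%:R + q = - (n%:R - q)); last by ring.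
    rewrite !powRN.
    rewrite lef_pV2 ?posrE ?powR_gt0 ?(lt_le_trans j0)//.
    apply: ge0_ler_powR; rewrite ?nnegrE ?subr_ge0 ?(ltW j0) ?(le_trans (ltW j0))//.
  - exact: space_cutoff_ge.
rewrite integral_cst// [X in (_ * X)%E](_ : _ = (r ^+ n)%:E); last first.
  have r20 : 0 <= r / 2 by rewrite divr_ge0// ltW.
  by apply: (etrans (lebesgue_box r20)); rewrite mulrCA divff ?mulr1.
rewrite -EFinM lee_fin le_eqVlt; apply/orP; left; apply/eqP.
rewrite /m powRM ?(ltW r0)//.
rewrite -(powR_mulrn n (ltW r0)).
have -> : r `^ q = r `^ (- n%:R + q) * r `^ n%:R.
  by rewrite -powRD ?(gt_eqF r0) ?implybT//; congr (_ `^ _); ring.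
ring.
Qed.

End main.

Lemma powR_not_bounded (R : realType) (A K q m : R) : 0 < A -> m < q ->
  exists2 r : R, 1 <= r & K * r `^ m < A * r `^ q.
Proof.
move=> A0 mq; have d0 : 0 < q - m by rewrite subr_gt0.
(* With r = B^(1/(q-m)), r^(q-m) = B exceeds K / A whatever the sign of K, and B >= 1 ensures r >=
   1. *)
pose B := 1 + `|K / A|; have B1 : 1 <= B by rewrite lerDl.
have B0 : 0 < B by apply: lt_le_trans B1.
exists (B `^ (q - m)^-1).
  by rewrite -[leLHS](powRr0 B) ler_powR// invr_ge0 ltW.
have r0 : 0 < B `^ (q - m)^-1 by rewrite powR_gt0// (lt_le_trans _ B1).
set r := B `^ _ in r0 *.
have -> : r `^ q = r `^ (q - m) * r `^ m.
  by rewrite -powRD ?(gt_eqF r0) ?implybT// subrK.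
rewrite mulrA ltr_pM2r ?powR_gt0//.
rewrite /r -powRrM mulVf ?gt_eqF// powRr1 ?(ltW B0)//.
rewrite mulrC -ltr_pdivrMr//; apply: le_lt_trans (ler_norm _) _.
by rewrite /B ltrDr.
Qed.

Theorem theorem3p1 (R : realType) (n : nat) (q gamma p eps : R)
    (u0 u1 : 'rV[R]_n -> R) :
  (1 <= n)%N ->
  0 < q < n%:R / 2 ->
  0 <= gamma < n%:R ->
  1 < p < p_crit n q gamma ->
  pseudo_measure_fun q u0 ->
  pseudo_measure_fun q u1 ->
  (exists c : R, 0 < c /\
    forall x : 'rV[R]_n, c * japanese_bracket x `^ (- n%:R + q) <= u0 x + u1 x) ->
  0 < eps ->
  ~ exists u : R -> 'rV[R]_n -> R, global_weak_solution gamma p eps u0 u1 u.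
Proof.
move=> n0 /andP[q0 qn2] gn /andP[p1 pc] _ _ [c [c0 Hc]] eps0 [u sol].
have nn : 0 < n%:R :> R by rewrite ltr0n.
have qn : 0 < n%:R - q by lra.
have [K HK] := weak_solution_bound n0 gn p1 sol.
(* The coefficient of r^q in the lower bound of the data term. *)
pose A := eps * flat 0 1 * (c * (n%:R + 1) `^ (- n%:R + q) * flat 0 (3 / 4) ^+ n).
have A0 : 0 < A.
  apply: mulr_gt0; first by rewrite mulr_gt0// flat_gt0.
  apply: mulr_gt0; first by rewrite mulr_gt0// powR_gt0// addr_gt0.
  by apply/exprn_gt0/flat_gt0; rewrite divr_gt0.
(* This is p < p_crit rewritten as (n - q)(p - 1) < 2 + gamma. *)
have mq : n%:R - (2 + gamma) / (p - 1) < q.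
  have p10 : 0 < p - 1 by rewrite subr_gt0.
  rewrite ltrBlDr -ltrBlDl ltr_pdivlMr// mulrC -ltr_pdivlMr//.
  by move: pc; rewrite /p_crit; lra.
have [r r1] := powR_not_bounded K A0 mq.
have r0 : 0 < r by apply: lt_le_trans r1.
rewrite ltNge => /negP; apply; rewrite -lee_fin; apply: le_trans (HK r r1).
(* The integrability demanded by the weak formulation supplies the measurability of the data times
   the cutoff. *)
have [_ weak] := sol.
have [_ _ _ Id _] :=
  weak _ _ (time_test_function_cutoff r0) (test_function_space_cutoff r0).
have := data_ge _ c0 Hc r1 (measurable_int _ Id); rewrite -subr_ge0 => /(_ (ltW qn)) h.
rewrite /A -mulrA EFinM; apply: lee_wpmul2l h.
by rewrite lee_fin mulr_ge0 ?flat_ge0// ltW.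
Qed.
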